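(* For $k\ge1$ let $(\mathcal{G}_k,\rightarrow)$ be the lattice of isomorphism classes of $k$-marked groups. (1) The meet and join operations of $(\mathcal{G}_k,\rightarrow)$ are computable for recursively presented groups (i.e. from $\nu_{RP}$-names of two $k$-marked groups one can compute $\nu_{RP}$-names of their meet and of their join). (2) The meet is computable for finitely presented groups (from $\nu_{FP}$-names one can compute a $\nu_{FP}$-name of the meet), but the join is not, since the join of two finitely presented marked groups does not have to be finitely presented. Even: the join of two marked groups whose underlying groups are free does not have to be finitely presented. (3) The join operation is computable for co-recursively presented groups (from $\nu_{co-RP}$-names one can compute a $\nu_{co-RP}$-name of the join), but the meet is not, since the meet of two co-recursively presented marked groups does not have to be co-recursively presented. (In (2) and (3), ''does not have to be'' means that there exist some $k$ and some pair of $k$-marked groups witnessing the failure.)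
   Context: A $k$-marked group is a pair $(G,S)$ with $G$ a group and $S=(s_1,\dots,s_k)\in G^k$ a tuple generating $G$. A morphism $(G,S)\to(H,S')$ of $k$-marked groups is a group homomorphism sending $s_i$ to $s_i'$ for each $i$; marked groups are considered up to isomorphism of marked groups. The set $\mathcal{G}_k$ of isomorphism classes of $k$-marked groups is ordered so that $(G,S)$ is above $(H,S')$ when there is a morphism $(G,S)\to(H,S')$. It is a lattice. If $(G,S)=\langle S\mid R_1\rangle$ and $(H,S)=\langle S\mid R_2\rangle$ (identifying the generating tuples), the meet is $(G,S)\wedge(H,S)=\langle S\mid R_1,R_2\rangle$. The join $(G,S)\vee(H,S')$ is the subgroup of $G\times H$ generated by $(s_1,s_1'),\dots,(s_k,s_k')$, marked by this tuple. Let $\langle n,m\rangle$ be a computable bijection $\mathbb{N}^2\to\mathbb{N}$ with computable inverse, $\mathcal{A}_n=\{x_1,\dots,x_n\}$, $\theta_n:\mathbb{N}\to(\mathcal{A}_n\cup\mathcal{A}_n^{-1})^*$ a natural computable bijection uniformly in $n\ge1$, $\Delta$ the standard numbering of finite subsets of $\mathbb{N}$, $\varphi_0,\varphi_1,\dots$ a standard enumeration of the partial computable functions, $W_i=\mathrm{dom}(\varphi_i)$. All presentations on $\mathcal{A}_n$ define groups marked by $(x_1,\dots,x_n)$. Then $\nu_{FP}(\langle n,m\rangle)=\langle\mathcal{A}_n\mid\theta_n(\Delta(m))\rangle$; $\nu_{RP}(\langle n,i\rangle)=\langle\mathcal{A}_n\mid\theta_n(W_i)\rangle$; and $\nu_{co-RP}(\langle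 n,i\rangle)=\langle\mathcal{A}_n\mid(\theta_n(W_i))^c\rangle$, with domain the set of $\langle n,i\rangle$ such that $\theta_n(W_i)$ is the co-word problem of an $n$-marked group, i.e. the set of all words defining non-identity elements of that marked group (complements are taken in $(\mathcal{A}_n\cup\mathcal{A}_n^{-1})^*$). A marked group is finitely, recursively, co-recursively presented if it is in the image of $\nu_{FP}$, $\nu_{RP}$, $\nu_{co-RP}$ respectively; integers mapped to it are its names. *)

(* Defs.v *)
From HB Require Import structures.
From mathcomp Require Import boolp.
From mathcomp Require Import all_boot.

Set Implicit Arguments.
Unset Strict Implicit.
Unset Printing Implicit Defensive.

Inductive murec : nat -> Type :=
| MZero k : murec k
| MSucc : murec 1
| MProj k : 'I_k -> murec k
| MComp k l : murec l -> ('I_l -> murec k) -> murec k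
| MRec k : murec k -> murec k.+2 -> murec k.+1
| MMin k : murec k.+1 -> murec k.

Fixpoint primrec_rel k (base : k.-tuple nat -> nat -> Prop)
    (step : k.+2.-tuple nat -> nat -> Prop) (v : k.-tuple nat) (n : nat) :
    nat -> Prop :=
  if n is m.+1
  then fun r => exists2 s, primrec_rel base step v m s
                         & step [tuple of m :: s :: v] r
  else base v.

(* [murec_eval c v r]: the program [c] halts on input [v] with output [r]. *)
Fixpoint murec_eval k (c : murec k) : k.-tuple nat -> nat -> Prop :=
  match c in murec k return k.-tuple nat -> nat -> Prop with
  | MZero _ => fun _ r => r = 0
  | MSucc => fun v r => r = (thead v).+1
  | MProj _ i => fun v r => r = tnth v i
  | MComp _ l f g => fun v r =>
      exists2 w : l.-tuple nat,
        forall i, murec_eval (g i) v (tnth w i) & murec_eval f w r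
  | MRec _ f g => fun v r =>
      primrec_rel (murec_eval f) (murec_eval g) (behead_tuple v) (thead v) r
  | MMin _ f => fun v r =>
      murec_eval f [tuple of r :: v] 0 /\
      forall m, m < r -> exists y, murec_eval f [tuple of m :: v] y.+1
  end.

(* A partial function is a function to [option nat], undefined at [None]. *)
Definition partial_computable2 (f : nat -> nat -> option nat) : Prop :=
  exists c : murec 2,
    forall x y r, murec_eval c [tuple x; y] r <-> f x y = Some r.

Definition computable1 (f : nat -> nat) : Prop :=
  exists c : murec 1, forall x r, murec_eval c [tuple x] r <-> f x = r.

Definition computable2 (f : nat -> nat -> nat) : Prop :=
  exists c : murec 2, forall x y r, murec_eval c [tuple x; y] r <-> f x y = r.

Definition computable3 (f : nat -> nat -> nat -> nat) : Prop :=
  exists c : murec 3,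
    forall x y z r, murec_eval c [tuple x; y; z] r <-> f x y z = r.

Definition computable_pairing (pairing : nat -> nat -> nat) : Prop :=
  computable2 pairing /\
  exists p1 p2 : nat -> nat,
    [/\ computable1 p1, computable1 p2,
        forall n m, p1 (pairing n m) = n /\ p2 (pairing n m) = m
      & forall p, pairing (p1 p) (p2 p) = p].

(* An acceptable enumeration of the unary partial computable functions, in the
   sense of Rogers: a universal function and the s-m-n property.  The second
   clause makes [phi] exhaust the unary partial computable functions. *)
Definition standard_enumeration (phi : nat -> nat -> option nat) : Prop :=
  partial_computable2 phi /\
  forall f, partial_computable2 f ->
    exists2 s, computable1 s & forall x y, phi (s x) y = f x y.

Definition W (phi : nat -> nat -> option nat) (i : nat) : pred nat :=
  fun x => isSome (phi i x).

(* The finite set with canonical index [m] = sum of the 2 ^ x for x in it. *)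
Definition Delta (m : nat) : pred nat := fun x => odd (m %/ 2 ^ x).

Local Open Scope group_scope.

(* [(i, false)] is the letter x_(i+1) and [(i, true)] is its inverse. *)
Definition letter (n : nat) := ('I_n * bool)%type.
Definition word (n : nat) := seq (letter n).

Definition letter_inv n (a : letter n) : letter n := (a.1, ~~ a.2).
Definition word_inv n (w : word n) : word n := rev (map (@letter_inv n) w).

Definition letter_code n (a : letter n) : nat := (a.1.*2 + a.2)%N.

(* Uniform computability of [theta]: the length and the letters of
   [theta n m] are computable from [n] and [m].  Letting [n = 0] costs nothing:
   [theta 0 m] is always the empty word. *)
Definition computable_word_numbering (theta : forall n, nat -> word n) : Prop :=
  [/\ forall n, (0 < n)%N -> bijective (theta n),
      computable2 (fun n m => size (theta n m))
    & computable3 (fun n m j => nth 0 (map (@letter_code n) (theta n m)) j)].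

Definition eval_letter n (G : groupType) (S : 'I_n -> G) (a : letter n) : G :=
  if a.2 then (S a.1)^-1 else S a.1.

Definition eval_word n (G : groupType) (S : 'I_n -> G) (w : word n) : G :=
  \prod_(a <- w) eval_letter S a.

Definition gen_by (I : Type) (G : groupType) (S : I -> G) : pred G := fun x =>
  `[< forall A : {pred G}, group_closed A -> (forall i, S i \in A) -> x \in A >].

Record marked_group (k : nat) := MarkedGroup {
  mg_group :> groupType;
  mg_gen : 'I_k -> mg_group;
  mg_genP : forall x, gen_by mg_gen x
}.

Definition mg_eval k (G : marked_group k) : word k -> G := eval_word (@mg_gen k G).

Definition mg_above k (G H : marked_group k) : Prop :=
  exists f : {multiplicative G -> H}, forall i, f (mg_gen G i) = mg_gen H i.

Definition mg_iso k (G H : marked_group k) : Prop :=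
  exists2 f : {multiplicative G -> H}, bijective f &
    forall i, f (mg_gen G i) = mg_gen H i.

Definition free_group (G : groupType) : Prop :=
  exists (I : Type) (b : I -> G), forall (K : groupType) (f : I -> K),
    exists2 h : {multiplicative G -> K}, forall i, h (b i) = f i &
      forall h' : {multiplicative G -> K}, (forall i, h' (b i) = f i) -> h' =1 h.

(* The congruence on words generated by the relators. *)
Inductive pres_eq k (R : word k -> Prop) : word k -> word k -> Prop :=
| PresRel w : R w -> pres_eq R w [::]
| PresInv a : pres_eq R [:: a; letter_inv a] [::]
| PresCat u u' v v' :
    pres_eq R u u' -> pres_eq R v v' -> pres_eq R (u ++ v) (u' ++ v')
| PresRefl u : pres_eq R u u
| PresSym u v : pres_eq R u v -> pres_eq R v u
| PresTrans u v w : pres_eq R u v -> pres_eq R v w -> pres_eq R u w.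

Local Open Scope quotient_scope.

Section Presented.
Variables (k : nat) (R : word k -> Prop).

Definition pres_eqb : rel (word k) := fun u v => `[< pres_eq R u v >].

Lemma pres_eqb_equiv : equiv_class_of pres_eqb.
Proof.
split=> [u|u v|v u w].
- by apply/asboolP; apply: PresRefl.
- by apply/asboolP/asboolP; apply: PresSym.
- by move=> /asboolP uv /asboolP vw; apply/asboolP; apply: PresTrans uv vw.
Qed.

Canonical pres_equiv := EquivRelPack pres_eqb_equiv.

Definition pres_type := {eq_quot pres_equiv}.
HB.instance Definition _ := Choice.on pres_type.
HB.instance Definition _ := EqQuotient.on pres_type.

Definition pres_pi (w : word k) : pres_type := \pi_pres_type w.

Lemma pres_piP u v : pres_pi u = pres_pi v <-> pres_eq R u v.
Proof.
split=> [/eqP|uv]; first by rewrite /pres_pi piE => /asboolP.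
by apply/eqP; rewrite /pres_pi piE; apply/asboolP.
Qed.

Lemma pres_reprK (x : pres_type) : pres_pi (repr x) = x.
Proof. exact: reprK. Qed.

Definition pres_mul (x y : pres_type) := pres_pi (repr x ++ repr y).
Definition pres_one := pres_pi [::].
Definition pres_inv (x : pres_type) := pres_pi (word_inv (repr x)).

Lemma pres_pi_repr w : pres_eq R (repr (pres_pi w)) w.
Proof. by apply/pres_piP; rewrite pres_reprK. Qed.

Lemma pres_mul_pi u v : pres_mul (pres_pi u) (pres_pi v) = pres_pi (u ++ v).
Proof. by apply/pres_piP; apply: PresCat; apply: pres_pi_repr. Qed.

Lemma pres_mulA : associative pres_mul.
Proof.
move=> x y z; rewrite -[x]pres_reprK -[y]pres_reprK -[z]pres_reprK.
by rewrite !pres_mul_pi catA.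
Qed.

Lemma pres_mul1 : left_id pres_one pres_mul.
Proof. by move=> x; rewrite -[x]pres_reprK pres_mul_pi. Qed.

Lemma pres_mulr1 : right_id pres_one pres_mul.
Proof. by move=> x; rewrite -[x]pres_reprK pres_mul_pi cats0. Qed.

Lemma letter_invK : involutive (@letter_inv k).
Proof. by case=> i b; rewrite /letter_inv /= negbK. Qed.

Lemma word_invK : involutive (@word_inv k).
Proof.
by move=> w; rewrite /word_inv map_rev revK -map_comp (eq_map letter_invK) map_id.
Qed.

Lemma pres_eq_invr (w : word k) : pres_eq R (w ++ word_inv w) [::].
Proof.
elim: w => [|a w IH]; first exact: PresRefl.
have -> : (a :: w) ++ word_inv (a :: w) =
          [:: a] ++ (w ++ word_inv w) ++ [:: letter_inv a].
  by rewrite /word_inv /= rev_cons -cats1 !catA.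
apply: PresTrans (PresInv R a).
apply: (@PresCat _ _ [:: a] [:: a]); first exact: PresRefl.
exact: (@PresCat _ _ _ [::] _ _ IH (PresRefl R _)).
Qed.

Lemma pres_eq_invl (w : word k) : pres_eq R (word_inv w ++ w) [::].
Proof. by have := pres_eq_invr (word_inv w); rewrite word_invK. Qed.

Lemma pres_mulV : left_inverse pres_one pres_inv pres_mul.
Proof.
move=> x; rewrite /pres_inv -{2}[x]pres_reprK pres_mul_pi.
by apply/pres_piP; apply: pres_eq_invl.
Qed.

Lemma pres_mulrV : right_inverse pres_one pres_inv pres_mul.
Proof.
move=> x; rewrite /pres_inv -{1}[x]pres_reprK pres_mul_pi.
by apply/pres_piP; apply: pres_eq_invr.
Qed.

HB.instance Definition _ := isGroup.Build pres_type
  pres_mulA pres_mul1 pres_mulr1 pres_mulV pres_mulrV.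

End Presented.

Section PresentedGroup.
Variables (k : nat) (R : word k -> Prop).

Definition pres_gen (i : 'I_k) : pres_type R := pres_pi R [:: (i, false)].

Lemma pres_eval (w : word k) : eval_word pres_gen w = pres_pi R w.
Proof.
elim: w => [|[i b] w IH]; first by rewrite /eval_word big_nil.
rewrite /eval_word big_cons -/(eval_word _ w) IH -cat1s -pres_mul_pi.
congr (_ * _); case: b => //; rewrite /eval_letter /=.
apply: mulg1_eq; rewrite -[_ * _]/(pres_mul _ _) pres_mul_pi.
by apply/pres_piP; apply: (PresInv R (i, false)).
Qed.

Lemma eval_gen_by (G : groupType) (S : 'I_k -> G) (w : word k) :
  gen_by S (eval_word S w).
Proof.
apply/asboolP => A AG AS; have [A1 AF] := AG.
rewrite /eval_word; elim: w => [|a w IH]; first by rewrite big_nil.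
rewrite big_cons; apply: (group_closedM AG) => //.
by rewrite /eval_letter; case: a.2; first apply: (group_closedV AG).
Qed.

Lemma pres_genP (x : pres_type R) : gen_by pres_gen x.
Proof. by rewrite -[x]pres_reprK -pres_eval; apply: eval_gen_by. Qed.

Definition presented : marked_group k := MarkedGroup pres_genP.

End PresentedGroup.

(* A presentation of [G] is given by all its relators, so the meet is presented
   by the relators of [G] together with those of [H]. *)
Definition mg_meet k (G H : marked_group k) : marked_group k :=
  presented (fun w => mg_eval G w = 1 \/ mg_eval H w = 1).

Section Join.
Variables (k : nat) (G H : marked_group k).

Definition join_pair (i : 'I_k) : (G * H)%type := (mg_gen G i, mg_gen H i).

Definition join_type := {x : (G * H)%type | gen_by join_pair x}.
HB.instance Definition _ := SubChoice.on join_type.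

Lemma join_closed : group_closed (gen_by join_pair).
Proof.
split=> [|x y /asboolP Sx /asboolP Sy]; apply/asboolP => A AG AS.
  exact: AG.1.
by apply: AG.2; [apply: Sx|apply: Sy].
Qed.

HB.instance Definition _ :=
  SubChoice_isSubGroup.Build _ (gen_by join_pair) join_type join_closed.

Lemma join_pairP i : gen_by join_pair (join_pair i).
Proof. by apply/asboolP. Qed.

Definition join_gen (i : 'I_k) : join_type := exist _ (join_pair i) (join_pairP i).

Lemma join_genP (x : join_type) : gen_by join_gen x.
Proof.
apply/asboolP => A AG AS; case: x => x Sx.
pose B : {pred (G * H)%type} :=
  fun y => `[< exists2 z : join_type, z \in A & val z = y >].
have : x \in B.
  move/asboolP: (Sx); apply=> [|i]; last by apply/asboolP; exists (join_gen i).
  split; first by apply/asboolP; exists 1; [exact: AG.1 | exact: val1].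
  move=> _ _ /asboolP[y Ay <-] /asboolP[z Az <-]; apply/asboolP.
  by exists (y / z); [exact: AG.2 | exact: gmulfF].
by case/asboolP=> z Az zx; rewrite (_ : exist _ x Sx = z) //; apply/val_inj.
Qed.

Definition mg_join : marked_group k := MarkedGroup join_genP.

End Join.

Section Lattice.
Variable k : nat.
Implicit Types (G H K : marked_group k) (R : word k -> Prop).

Lemma mg_morph_eval G H (f : {multiplicative G -> H}) :
  (forall i, f (mg_gen G i) = mg_gen H i) ->
  forall w, f (mg_eval G w) = mg_eval H w.
Proof.
move=> fS; have f1 : f 1 = 1.
  by apply: (@mulgI _ (f 1)); rewrite -gmulfM !mulg1.
have fV x : f x^-1 = (f x)^-1.
  by apply/esym/mulg1_eq; rewrite -gmulfM mulgV.
rewrite /mg_eval /eval_word; elim=> [|a w IH]; first by rewrite !big_nil.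
rewrite !big_cons gmulfM IH; congr (_ * _).
by rewrite /eval_letter; case: a.2; rewrite ?fV fS.
Qed.

Lemma mg_eval_cat G u v : mg_eval G (u ++ v) = mg_eval G u * mg_eval G v.
Proof. exact: big_cat. Qed.

Lemma mg_eval_inv G w : mg_eval G (word_inv w) = (mg_eval G w)^-1.
Proof.
rewrite /mg_eval /eval_word /word_inv; elim: w => [|[i b] w IH].
  by rewrite !big_nil invg1.
rewrite /= rev_cons -cats1 big_cat !big_cons big_nil IH invgM /= mulg1.
congr (_ * _).
by rewrite /eval_letter; case: b => //=; rewrite invgK.
Qed.

Lemma mg_eval_surj G (x : G) : exists w, mg_eval G w = x.
Proof.
have /asboolP := mg_genP x.
move/(_ (fun y => `[< exists w, mg_eval G w = y >])) => GA.
suff /asboolP[w <-] : x \in (fun y : G => `[< exists w, mg_eval G w = y >]).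
  by exists w.
apply: GA => [|i].
  split; first by apply/asboolP; exists [::]; apply: big_nil.
  move=> _ _ /asboolP[u <-] /asboolP[v <-]; apply/asboolP.
  by exists (u ++ word_inv v); rewrite mg_eval_cat mg_eval_inv.
by apply/asboolP; exists [:: (i, false)]; apply: big_seq1.
Qed.

Lemma mg_aboveP G H :
  mg_above G H <-> forall w, mg_eval G w = 1 -> mg_eval H w = 1.
Proof.
split=> [[f fS] w Gw|GH].
  rewrite -(mg_morph_eval fS) Gw.
  by apply: (@mulgI _ (f 1)); rewrite -gmulfM !mulg1.
pose f (x : G) : H := mg_eval H (projT1 (cid (mg_eval_surj x))).
have fE w : f (mg_eval G w) = mg_eval H w.
  rewrite /f; case: cid => u /= uw; apply: (@mulIg _ (mg_eval H w)^-1).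
  rewrite mulgV -mg_eval_inv -mg_eval_cat; apply: GH.
  by rewrite mg_eval_cat mg_eval_inv uw mulgV.
have fM : {morph f : x y / x * y}.
  move=> x y; case: (mg_eval_surj x) (mg_eval_surj y) => [u <-] [v <-].
  by rewrite -mg_eval_cat !fE mg_eval_cat.
pose fm := isMultiplicative.Build G H f fM.
pose F : {multiplicative G -> H} := HB.pack f fm.
exists F => i; change (f (mg_gen G i) = mg_gen H i).
have gE (K : marked_group k) : mg_gen K i = mg_eval K [:: (i, false)].
  by rewrite /mg_eval /eval_word big_seq1.
by rewrite !gE fE.
Qed.

Lemma mg_isoP G H : mg_iso G H <-> mg_above G H /\ mg_above H G.
Proof.
split=> [[f [g fK gK] fS]|[[f fS] [g gS]]].
  have gM : {morph g : x y / x * y} by apply: can2_gmulfM.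
  split; first by exists f.
  pose gm := isMultiplicative.Build H G g gM.
  pose F : {multiplicative H -> G} := HB.pack g gm.
  by exists F => i; rewrite -fS; apply: fK.
exists f => //; exists g => x.
  by case: (mg_eval_surj x) => w <-; rewrite !mg_morph_eval.
by case: (mg_eval_surj x) => w <-; rewrite !mg_morph_eval.
Qed.

Lemma presented_eval R w : mg_eval (presented R) w = 1 <-> pres_eq R w [::].
Proof. by rewrite /mg_eval pres_eval -pres_piP. Qed.

Lemma presented_above R H :
  mg_above (presented R) H <-> forall w, R w -> mg_eval H w = 1.
Proof.
rewrite mg_aboveP; split=> [RH w Rw|RH w].
  by apply/RH/presented_eval/PresRel.
have H1 : mg_eval H [::] = 1 by apply: big_nil.
rewrite presented_eval -H1; elim=> {w} [w Rw|a|||//|u v w _ -> _ -> //].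
- by rewrite H1; apply: RH.
- rewrite H1 -[[:: a; _]]/([:: a] ++ word_inv [:: a]).
  by rewrite mg_eval_cat mg_eval_inv mulgV.
- by move=> u u' v v' _ Eu _ Ev; rewrite !mg_eval_cat Eu Ev.
- by [].
Qed.

(* [mg_meet] is the greatest lower bound and, by [mg_joinP], [mg_join] the least
   upper bound for [mg_above]. *)
Lemma mg_meetP G H K :
  mg_above (mg_meet G H) K <-> mg_above G K /\ mg_above H K.
Proof.
rewrite /mg_meet presented_above !mg_aboveP.
split=> [GHK|[GK HK] w [/GK|/HK] //].
by split=> w ?; apply: GHK; [left|right].
Qed.

Lemma join_eval G H w : mg_eval (mg_join G H) w = 1 <->
  mg_eval G w = 1 /\ mg_eval H w = 1.
Proof.
have val_eval : val (mg_eval (mg_join G H) w) = (mg_eval G w, mg_eval H w).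
  rewrite /mg_eval /eval_word; elim: w => [|a w IH].
    by rewrite !big_nil; apply: val1.
  rewrite !big_cons valM IH.
  have -> : val (eval_letter (@join_gen _ G H) a) =
            (eval_letter (mg_gen G) a, eval_letter (mg_gen H) a).
    by rewrite /eval_letter; case: a.2 => //; rewrite gmulfV.
  by [].
split=> [w1|[Gw Hw]].
  by move: val_eval; rewrite w1 val1 => -[<- <-].
by apply/val_inj; rewrite val_eval Gw Hw val1.
Qed.

Lemma mg_joinP G H K :
  mg_above K (mg_join G H) <-> mg_above K G /\ mg_above K H.
Proof.
rewrite !mg_aboveP; split=> [KJ|[KG KH] w Kw].
  by split=> w /KJ/join_eval[].
by apply/join_eval; split; [apply: KG|apply: KH].
Qed.

Lemma mg_meet_presented R1 R2 :
  mg_iso (mg_meet (presented R1) (presented R2))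
         (presented (fun w => R1 w \/ R2 w)).
Proof.
apply/mg_isoP; split.
  rewrite mg_meetP !presented_above.
  by split=> w Rw; apply/presented_eval/PresRel; [left|right].
rewrite presented_above => w [Rw|Rw].
  by apply/presented_eval/PresRel; left; apply/presented_eval/PresRel.
by apply/presented_eval/PresRel; right; apply/presented_eval/PresRel.
Qed.

End Lattice.

(* [nu k p G]: the integer [p] is a name of the [k]-marked group [G], which
   only matters up to isomorphism of marked groups. *)
Definition numbering := forall k : nat, nat -> marked_group k -> Prop.

Definition presentable (nu : numbering) k (G : marked_group k) : Prop :=
  exists p, nu k p G.

Definition computable_op (nu : numbering) k
    (op : marked_group k -> marked_group k -> marked_group k) : Prop :=
  exists2 F : nat -> nat -> option nat, partial_computable2 F &
    forall a b (G H : marked_group k), nu k a G -> nu k b H ->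
      exists2 c, F a b = Some c & nu k c (op G H).

Section Numberings.
Variables (pairing : nat -> nat -> nat) (theta : forall n, nat -> word n).
Variable phi : nat -> nat -> option nat.

Definition theta_image n (A : pred nat) : word n -> Prop :=
  fun w => exists2 x, A x & theta n x = w.

Definition nu_FP : numbering := fun n p G =>
  exists2 m, p = pairing n m & mg_iso (presented (@theta_image n (Delta m))) G.

Definition nu_RP : numbering := fun n p G =>
  exists2 i, p = pairing n i & mg_iso (presented (@theta_image n (W phi i))) G.

Definition co_word_problem n (A : word n -> Prop) (G : marked_group n) : Prop :=
  forall w, A w <-> mg_eval G w <> 1.

Definition nu_coRP : numbering := fun n p G =>
  exists i, [/\ p = pairing n i,
    exists H : marked_group n, co_word_problem (@theta_image n (W phi i)) H
    & mg_iso (presented (fun w => ~ @theta_image n (W phi i) w)) G].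

End Numberings.

(* Main.v *)
From HB Require Import structures.
Require Import Defs.
From mathcomp Require Import boolp.
From mathcomp Require Import all_boot all_order all_algebra.
From mathcomp Require Import zify.
From Stdlib Require Import Relation_Operators Operators_Properties.

Set Implicit Arguments.
Unset Strict Implicit.
Unset Printing Implicit Defensive.

(* A word is trivial in the join iff it is trivial in both groups, and the
   relators of the two groups together present the meet.  The positive results
   follow, since unions and intersections of recursively enumerable sets can be
   computed, and since the consequences of a recursively enumerable set of
   relators are recursively enumerable.

   Join of finitely presented groups: let G = <t, a, b | b> and
   H = <t, a, b | a>, both free of rank 2.  In the join, [a^(t^n), b] = 1 for all
   n.  Let t act on Z by translation, a by the transposition (0 1) and b by
   (s s+1), with s large.  A word of length at most N moves a point by at most N,
   so the orbit of a point under it does not meet both supports; hence short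
   words that are trivial in G and in H act trivially.  But [a^(t^(s+1)), b] does
   not act trivially.

   Meet of co-recursively presented groups: a group generated by finitely many
   computable permutations is co-recursively presented.  For a set c of integers
   there are four involutions for which the commutator word u_n acts trivially
   if n is not in c, and as a fixed nontrivial permutation otherwise.  Let
   c1(m) = {2m} u {2<m,t>+1 : phi_m(m) is seen to halt at stage t} and
   c2(m) = {2m}, and let G and H act on the disjoint union over m of the actions
   given by c1(m) and by c2(m).  If phi_m(m) halts at stage t, then
   u_2m = u_(2<m,t>+1) in G and u_(2<m,t>+1) = 1 in H, so u_2m = 1 in the meet.
   Otherwise c1(m) = c2(m), and this fibre is a quotient of the meet in which u_2m
   is nontrivial.  So the co-word problem of the meet is not recursively
   enumerable. *)

(** * Words and presentations *)

Section MarkedGroups.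
Local Open Scope group_scope.

(** Isomorphism of marked groups becomes equality of word problems, the form in which all later
    comparisons are made. *)
Lemma mg_iso_wordP k (G H : marked_group k) :
  mg_iso G H <-> forall w, mg_eval G w = 1 <-> mg_eval H w = 1.
Proof.
rewrite mg_isoP !mg_aboveP; split=> [[GH HG] w|GH].
  by split; [apply: GH | apply: HG].
by split=> w /GH.
Qed.

Lemma mg_eval_nil k (G : marked_group k) : mg_eval G [::] = 1.
Proof. exact: big_nil. Qed.

(** Lets a word problem serve as a set of relators, as is done for the join and for co-recursive
    presentations. *)
Lemma presented_wordsK k (G : marked_group k) :
  mg_iso (presented (fun w => mg_eval G w = 1)) G.
Proof.
apply/mg_isoP; split; first exact/presented_above.
by apply/mg_aboveP => w Gw; apply/presented_eval/PresRel.
Qed.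

Lemma mg_meet_iso k (G G' H H' : marked_group k) :
  mg_iso G G' -> mg_iso H H' -> mg_iso (mg_meet G H) (mg_meet G' H').
Proof.
move=> /mg_iso_wordP GG' /mg_iso_wordP HH'; rewrite /mg_meet.
have -> : (fun w => mg_eval G w = 1 \/ mg_eval H w = 1) =
    (fun w => mg_eval G' w = 1 \/ mg_eval H' w = 1).
  by apply/funext => w; apply/propext; rewrite GG' HH'.
exact/mg_iso_wordP.
Qed.

Lemma mg_iso_trans k (G H K : marked_group k) :
  mg_iso G H -> mg_iso H K -> mg_iso G K.
Proof.
by move=> /mg_iso_wordP GH /mg_iso_wordP HK; apply/mg_iso_wordP => w;
  rewrite GH.
Qed.

(** Reduces the meet to a union of relator sets, for arbitrary presentations of the two groups. *)
Lemma pres_meet_iso k (R1 R2 R : word k -> Prop) (G H : marked_group k) :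
    mg_iso (presented R1) G -> mg_iso (presented R2) H ->
    (forall w, R w <-> R1 w \/ R2 w) ->
  mg_iso (presented R) (mg_meet G H).
Proof.
move=> R1G R2H RE.
have -> : R = fun w => R1 w \/ R2 w by apply/funext => w; apply/propext.
have RM := mg_meet_presented R1 R2; have := mg_meet_iso R1G R2H.
apply: mg_iso_trans; apply/mg_iso_wordP => w.
by move/mg_iso_wordP: RM => ->.
Qed.

(** One insertion or deletion of a relator or of a cancelling pair. The congruence becomes
    reachability under this symmetric relation, and finite chains can be enumerated. *)
Variant relator_step k (R : word k -> Prop) (u v : word k) : Prop :=
  RelatorStep p q r of R r \/ (exists a, r = [:: a; letter_inv a]) &
    (u = p ++ q /\ v = p ++ r ++ q) \/ (v = p ++ q /\ u = p ++ r ++ q).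

Lemma relator_step_cat k (R : word k -> Prop) x y u v :
  relator_step R u v -> relator_step R (x ++ u ++ y) (x ++ v ++ y).
Proof.
case=> p q r Rr uv; exists (x ++ p) (q ++ y) r => //.
by case: uv => -[-> ->]; [left|right]; rewrite !catA.
Qed.

(** Steps survive in any context, so a product is rewritten one factor at a time; symmetry holds
    because each step can be undone by a step. *)
Lemma pres_eq_steps k (R : word k -> Prop) u v :
  pres_eq R u v <-> clos_refl_trans (word k) (relator_step R) u v.
Proof.
split.
  have cat_rt x y u' v' : clos_refl_trans (word k) (relator_step R) u' v' ->
      clos_refl_trans (word k) (relator_step R) (x ++ u' ++ y) (x ++ v' ++ y).
    elim=> [{}u' {}v' st|z|{}u' {}v' w' _ IH _ IH'].
    - exact/rt_step/relator_step_cat.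
    - exact: rt_refl.
    - exact: rt_trans IH IH'.
  elim=> [w Rw|a|x x' y y' _ IHx _ IHy|w|w w' _|w w' w'' _ IH _ IH'].
  - by apply: rt_step; exists [::] [::] w; [left|right; rewrite /= cats0].
  - by apply: rt_step; exists [::] [::] [:: a; letter_inv a];
      [right; exists a|right].
  - apply: rt_trans (cat_rt [::] y _ _ IHx) _ => /=.
    by have := cat_rt x' [::] _ _ IHy; rewrite !cats0.
  - exact: rt_refl.
  - elim=> [x y [p q r Rr xy]|x|x y z _ IH _ IH'].
    + by apply: rt_step; exists p q r => //; case: xy; [right|left].
    + exact: rt_refl.
    + exact: rt_trans IH' IH.
  - exact: rt_trans IH IH'.
elim=> [x y [p q r Rr xy]|x|x y z _ IH _ IH'].
- have pq : pres_eq R (p ++ r ++ q) (p ++ q).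
    apply: PresCat; first exact: PresRefl.
    rewrite -[X in pres_eq R _ X]/([::] ++ q); apply: PresCat (PresRefl _ _).
    by case: Rr => [/PresRel|[a ->]] //; apply: PresInv.
  by case: xy => -[-> ->] //; apply: PresSym.
- exact: PresRefl.
- exact: PresTrans IH IH'.
Qed.
End MarkedGroups.

(** * Groups given by permutations of a set *)

Section Actions.
Local Open Scope group_scope.
Variables (k : nat) (T : Type) (act : letter k -> T -> T).
Hypothesis actK : forall a, cancel (act a) (act (letter_inv a)).

Definition acts (w : word k) (x : T) : T := foldl (fun y a => act a y) x w.

Lemma acts_cat u v x : acts (u ++ v) x = acts v (acts u x).
Proof. exact: foldl_cat. Qed.

Lemma acts_invK w : cancel (acts w) (acts (word_inv w)).
Proof.
elim: w => [|a w IH] x //; rewrite /word_inv /= rev_cons -cats1 acts_cat.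
by rewrite IH /= actK.
Qed.

(** By [act_group_eq1] this is the permutation group generated by the letters; presenting it by the
    words that act trivially avoids building a group of permutations. *)
Definition act_group : marked_group k := presented (fun w => acts w =1 id).

Lemma act_group_eq u v : mg_eval act_group u = mg_eval act_group v <->
  acts u =1 acts v.
Proof.
rewrite /mg_eval !pres_eval pres_piP; split=> [|uv].
  elim=> {u v} [w|a|u u' v v' _ uu' _ vv'||u v _ uv|u v w _ uv _ vw] // x.
  - by rewrite /= actK.
  - by rewrite !acts_cat uu' vv'.
  - by rewrite uv.
(* If [u] and [v] act alike, then [u ++ word_inv v] is itself one of the relators. *)
have uv1 : pres_eq (fun w => acts w =1 id) (u ++ word_inv v) [::].
  by apply: PresRel => x; rewrite acts_cat uv acts_invK.
rewrite -[u]cats0; apply: PresTrans (_ : pres_eq _ (u ++ word_inv v ++ v) v).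
  by apply: PresCat (PresRefl _ _) (PresSym (pres_eq_invl _ _)).
by rewrite catA; apply: (PresCat (v' := v) uv1 (PresRefl _ _)).
Qed.

Lemma act_group_eq1 w : mg_eval act_group w = 1 <-> acts w =1 id.
Proof.
have e1 : mg_eval act_group [::] = 1 by apply: big_nil.
by rewrite -e1; apply: act_group_eq.
Qed.
End Actions.

(** * Morphisms out of presented groups, and freeness *)

Section FreeGroups.
Local Open Scope group_scope.

Lemma morph_eval k (G : marked_group k) (K : groupType)
    (f : {multiplicative G -> K}) w :
  f (mg_eval G w) = eval_word (fun i => f (mg_gen G i)) w.
Proof.
have f1 : f 1 = 1 by apply: (@mulgI _ (f 1)); rewrite -gmulfM !mulg1.
have fV x : f x^-1 = (f x)^-1.
  by apply/esym/mulg1_eq; rewrite -gmulfM mulgV.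
rewrite /mg_eval /eval_word; elim: w => [|a w IH]; first by rewrite !big_nil.
rewrite !big_cons gmulfM IH; congr (_ * _).
by rewrite /eval_letter; case: a.2; rewrite ?fV.
Qed.

(** Von Dyck's theorem for a target that [S] need not generate, as the universal property of a free
    group demands. *)
Lemma presented_morph k (R : word k -> Prop) (K : groupType) (S : 'I_k -> K) :
    (forall w, R w -> eval_word S w = 1) ->
  exists f : {multiplicative presented R -> K},
    forall i, f (mg_gen (presented R) i) = S i.
Proof.
move=> RS; have evalE u v : pres_eq R u v -> eval_word S u = eval_word S v.
  have eval1 : eval_word S [::] = 1 by apply: big_nil.
  have evalM x y : eval_word S (x ++ y) = eval_word S x * eval_word S y.
    exact: big_cat.
  elim=> {u v} [w /RS -> //|a|x x' y y' _ xx' _ yy'||//|x y z _ -> _ -> //] //.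
    rewrite eval1 /eval_word !big_cons big_nil mulg1 /eval_letter /=.
    by case: a.2; rewrite /= ?mulVg ?mulgV.
  by rewrite !evalM xx' yy'.
pose f (x : presented R) := eval_word S (repr (x : pres_type R)).
have fpi w : f (pres_pi R w) = eval_word S w by apply/evalE/pres_pi_repr.
have fM : {morph f : x y / x * y}.
  move=> x y; rewrite -[x]pres_reprK -[y]pres_reprK.
  rewrite -[_ * _]/(pres_mul _ _) pres_mul_pi !fpi.
  exact: big_cat.
pose fm := isMultiplicative.Build (presented R) K f fM.
pose F : {multiplicative presented R -> K} := HB.pack f fm.
exists F => i; rewrite -[F _]/(f (pres_pi R [:: (i, false)])) fpi.
exact: big_seq1.
Qed.

(** The remaining generators form a basis. *)
Lemma free_kill_generator k (i : 'I_k) :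
  free_group (presented (fun w => w = [:: (i, false)])).
Proof.
set R := fun w => _; set G := presented R.
have gi1 : mg_gen G i = 1.
  have <- : mg_eval G [:: (i, false)] = 1 by apply/presented_eval/PresRel.
  by rewrite /mg_eval /eval_word big_seq1.
exists {j | j != i}, (fun j => mg_gen G (val j)) => K f.
(* The killed generator has to go to 1; the others follow [f]. *)
pose S j := if insub j is Some j' then f j' else 1.
have Si : S i = 1 by rewrite /S insubF // eqxx.
have [|h hS] := @presented_morph k R K S.
  by move=> w ->; rewrite /eval_word big_seq1.
exists h => [j|h' h'f x]; first by rewrite hS /S valK.
have h'S j : h' (mg_gen G j) = S j.
  have [->|ji] := eqVneq j i; last by rewrite /S insubT -h'f.
  by rewrite gi1 Si; apply: (@mulgI _ (h' 1)); rewrite -gmulfM !mulg1.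
have [w <-] := mg_eval_surj x; rewrite !morph_eval.
by rewrite /eval_word; apply: eq_bigr => a _; rewrite /eval_letter h'S hS.
Qed.
End FreeGroups.

(** * A join of free groups that is not finitely presented *)

Section JoinNotFP.
Import Order.TTheory GRing.Theory Num.Theory.

Definition swap_succ (c x : int) : int :=
  (if x == c then c + 1 else if x == c + 1 then c else x)%R.

(** The last two generators are meant to act by involutions, so their inverse letters act as the
    letters themselves. *)
Definition line_act (A B : int -> int) (a : letter 3) (x : int) : int :=
  match val a.1 with
  | 0 => if a.2 then (x - 1)%R else (x + 1)%R
  | 1 => A x
  | _ => B x
  end.

Lemma line_actK A B : involutive A -> involutive B ->
  forall a, cancel (line_act A B a) (line_act A B (letter_inv a)).
Proof.
move=> AK BK [[[|[|i]] i3] b] x; rewrite /line_act /=; last 2 first.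
- exact: AK.
- exact: BK.
by case: b => /=; [apply: subrK | apply: addrK].
Qed.

Lemma swap_succK c : involutive (swap_succ c).
Proof. by move=> x; rewrite /swap_succ; do ?case: eqP; lia. Qed.

(* A short word cannot bring a point that is far from [c] to the places where
   the actions differ. *)
Lemma acts_far k (act act' : letter k -> int -> int) (c : int) w (x : int) :
    (forall a y, (y - 1 <= act a y <= y + 1)%R) ->
    (forall a y, (y < c \/ c + 1 < y)%R -> act a y = act' a y) ->
    (x + (size w)%:Z < c \/ c + 1 + (size w)%:Z < x)%R ->
  acts act w x = acts act' w x.
Proof.
move=> act1 actE; elim: w x => [|a w IH] x //= xc.
have := act1 a x; rewrite -(actE a x); last by lia.
move=> /andP[y1 y2]; apply: IH; lia.
Qed.

Let t b : letter 3 := (ord0, b).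
Let a b : letter 3 := (inord 1, b).
Let b b : letter 3 := (inord 2, b).

(** [kill (inord 2)] kills [b] and [kill (inord 1)] kills [a]: these are the two free groups whose
    join is studied. *)
Definition kill (i : 'I_3) := presented (fun w => w = [:: (i, false)]).

(** If the killed letter acts as the identity, the action factors through [kill i]. *)
Lemma kill_line_act (i : 'I_3) A B w : involutive A -> involutive B ->
    line_act A B (i, false) =1 id -> mg_eval (kill i) w = 1%g ->
  acts (line_act A B) w =1 id.
Proof.
move=> AK BK iE /(iffLR (mg_aboveP _ _) _ w) H.
apply/(act_group_eq1 (line_actK AK BK))/H.
by apply/presented_above => _ ->; apply/(act_group_eq1 (line_actK AK BK)).
Qed.

(** Finite presentability enters only through a bound [N] on the length of the relators. *)
Lemma join_kill_not_fp N (R : word 3 -> Prop) :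
    (forall w, R w -> size w <= N) ->
  ~ mg_iso (presented R) (mg_join (kill (inord 2)) (kill (inord 1))).
Proof.
move=> RN /mg_iso_wordP RJ; pose s : int := (2 * N + 5)%:Z.
pose A := swap_succ 0; pose B := swap_succ s.
have [AK BK] : involutive A /\ involutive B by split; apply: swap_succK.
have idK : involutive (@id int) by [].
pose K := act_group (line_act A B).
have line_act1 A' B' a' y : (forall y, (y - 1 <= A' y <= y + 1)%R) ->
    (forall y, (y - 1 <= B' y <= y + 1)%R) ->
    (y - 1 <= line_act A' B' a' y <= y + 1)%R.
  by move=> A1 B1; case: a' => [[[|[|i]] i3] [|]]; rewrite /line_act //=; lia.
have swap1 c y : (y - 1 <= swap_succ c y <= y + 1)%R.
  by rewrite /swap_succ; do ?case: eqP; lia.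
have swapE c y : (y < c \/ c + 1 < y)%R -> swap_succ c y = y.
  by rewrite /swap_succ; do ?case: eqP; lia.
have RK w : R w -> mg_eval K w = 1%g.
  move=> Rw; have : mg_eval (presented R) w = 1%g.
    exact/presented_eval/PresRel.
  move=> /RJ/join_eval[wG wH]; apply/(act_group_eq1 (line_actK AK BK)) => x.
  have wN := RN w Rw.
  (* The supports are {0, 1} and {s, s + 1}. In [N] letters a point below [N + 2] cannot reach the
     second one, and any other point cannot reach the first one. *)
  have [xs|xs] := boolP (x < N.+2%:Z)%R.
    rewrite (acts_far (act' := line_act A id) (c := s)).
    - apply: (kill_line_act (i := inord 2)) => // y.
      by rewrite /line_act /= inordK.
    - by move=> a' y; apply: line_act1; apply: swap1.
    - move=> [[[|[|i]] i3] b'] y yc; rewrite /line_act //=.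
      exact: swapE.
    - by rewrite /s; lia.
  rewrite (acts_far (act' := line_act id B) (c := 0)).
  - apply: (kill_line_act (i := inord 1)) => // y.
    by rewrite /line_act /= inordK.
  - by move=> a' y; apply: line_act1; apply: swap1.
  - move=> [[[|[|i]] i3] b'] y yc; rewrite /line_act //=.
    exact: swapE.
  - lia.
(* Here [n] is [s + 1]. Words are read from left to right, so [u] acts as the transposition of
   [s + 1] and [s + 2], which shares exactly one point with the support of [B]; [v] is the
   commutator of [u] and [b]. *)
pose n := (2 * N + 6)%N.
pose u := nseq n (t true) ++ a false :: nseq n (t false).
pose v := u ++ b false :: word_inv u ++ [:: b true].
have v1 : mg_eval (mg_join (kill (inord 2)) (kill (inord 1))) v = 1%g.
  have kill1 i : mg_eval (kill i) [:: (i, false)] = 1%g.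
    by apply/presented_eval/PresRel.
  have kill1V i : mg_eval (kill i) [:: (i, true)] = 1%g.
    rewrite -[[:: _]]/(word_inv [:: (i, false)]) mg_eval_inv kill1.
    exact: invg1.
  have vE i w : mg_eval (kill i) (w ++ b false :: word_inv w ++ [:: b true]) =
      (mg_eval (kill i) w * (mg_eval (kill i) [:: b false] *
        ((mg_eval (kill i) w)^-1 * mg_eval (kill i) [:: b true])))%g.
    by rewrite -cat1s !mg_eval_cat mg_eval_inv.
  (* Killing [b] reduces [v] to [u] times its inverse. Killing [a] makes [u] trivial and reduces [v]
     to [b] times its inverse. *)
  apply/join_eval; rewrite /v !vE; split.
    by rewrite kill1 kill1V mul1g mulg1 mulgV.
  have -> : mg_eval (kill (inord 1)) u = 1%g.
    rewrite /u -[a false :: _]cat1s !mg_eval_cat kill1 mul1g -mg_eval_cat.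
    have -> : nseq n (t false) = word_inv (nseq n (t true)).
      by rewrite /word_inv map_nseq rev_nseq.
    by rewrite mg_eval_cat mg_eval_inv mulgV.
  rewrite invg1 !mul1g -mg_eval_cat.
  rewrite -[[:: b true]]/(word_inv [:: b false]) mg_eval_cat mg_eval_inv.
  exact: mulgV.
have /mg_aboveP RaK : mg_above (presented R) K by apply/presented_above.
have /(act_group_eq1 (line_actK AK BK)) vid : mg_eval K v = 1%g.
  by apply/RaK/RJ.
have shift c x : acts (line_act A B) (nseq n (t c)) x =
    (if c then x - n%:Z else x + n%:Z)%R.
  rewrite /n; case: c; elim: (2 * N + 6) x => [|m IH] x /=;
    by rewrite ?IH /line_act /=; lia.
have uE x : acts (line_act A B) u x = swap_succ n%:Z x.
  rewrite /u -cat1s !acts_cat !shift /= /line_act /= inordK // /A /swap_succ.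
  by do ?case: eqP; lia.
have vE w x :
    acts (line_act A B) (w ++ b false :: word_inv w ++ [:: b true]) x =
    acts (line_act A B) [:: b true] (acts (line_act A B) (word_inv w)
      (acts (line_act A B) [:: b false] (acts (line_act A B) w x))).
  by rewrite -cat1s !acts_cat.
(* The point [s] is fixed by [u], sent to [s + 1] by [b] and on to [s + 2] by the inverse of [u],
   and [b] fixes [s + 2]; hence [v] moves [s]. *)
have := vid s; rewrite /v vE uE.
have -> : swap_succ n%:Z s = s by rewrite swapE // /s /n; lia.
have -> : acts (line_act A B) [:: b false] s = (s + 1)%R.
  by rewrite /= /line_act /= inordK // /B /swap_succ eqxx.
have -> : acts (line_act A B) (word_inv u) (s + 1)%R = (s + 2)%R.
  rewrite -[RHS](acts_invK (line_actK AK BK) u) uE; congr (acts _ _ _).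
  by rewrite /swap_succ /s /n; do ?case: eqP; lia.
rewrite /= /line_act /= inordK // /B swapE; lia.
Qed.
End JoinNotFP.

(** * Four involutions encoding a set of integers *)

Section Fibres.

(* [walk false] swaps 2i and 2i+1; [walk true] swaps 2i+1 and 2i+2 and fixes 0.
   Alternating them moves 0 to any given position. *)
Definition walk (e : bool) (n : nat) : nat :=
  if odd n (+) e then n.-1 else n.+1.

Definition transp (i x : nat) : nat :=
  if x == i then i.+1 else if x == i.+1 then i else x.

(** A point is a position on a half-line with a register. The first two generators move the
    position. The third transposes the register values 0 and 1 at the positions in [c], the fourth 1
    and 2 at position 0, and these two transpositions do not commute. *)
Definition fibre_act (c : pred nat) (l : letter 4) (x : nat * nat) : nat * nat :=
  match val l.1 with
  | 0 => (walk false x.1, x.2)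
  | 1 => (walk true x.1, x.2)
  | 2 => (x.1, if c x.1 then transp 0 x.2 else x.2)
  | _ => (x.1, if x.1 == 0 then transp 1 x.2 else x.2)
  end.

Definition family_act (c : nat -> pred nat) (l : letter 4)
    (x : nat * (nat * nat)) : nat * (nat * nat) :=
  (x.1, fibre_act (c x.1) l x.2).

Lemma walkK e : involutive (walk e).
Proof.
case=> [|n]; rewrite /walk /=; first by case: e.
by case: e; case E: (odd n) => //=; rewrite E //; case: n E => //= n ->.
Qed.

Lemma transpK i : involutive (transp i).
Proof.
move=> x; rewrite /transp; case: (x =P i) => [->|].
  by rewrite gtn_eqF ?eqxx.
by case: (x =P i.+1) => [->|/eqP/negbTE xi /eqP/negbTE xi'];
  rewrite ?eqxx // xi' xi.
Qed.

Lemma fibre_actK c l : cancel (fibre_act c l) (fibre_act c (letter_inv l)).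
Proof.
case: l => -[i i4] b [y r]; rewrite /fibre_act /=.
case: i i4 => [|[|[|i]]] _ /=.
- by rewrite walkK.
- by rewrite walkK.
- by case: (c y); rewrite ?transpK.
- by case: (y == 0); rewrite ?transpK.
Qed.

Lemma family_actK c l : cancel (family_act c l) (family_act c (letter_inv l)).
Proof. by case=> m x; rewrite /family_act /= fibre_actK. Qed.

Lemma acts_family c w m x :
  acts (family_act c) w (m, x) = (m, acts (fibre_act (c m)) w x).
Proof. by elim: w x => [|l w IH] x //=; rewrite IH. Qed.

Definition stepl (e : bool) : letter 4 := (inord e, false).
Definition mark : letter 4 := (inord 2, false).
Definition base : letter 4 := (ord_max, false).

Fixpoint path_word n : word 4 :=
  if n is m.+1 then path_word m ++ [:: stepl (odd m)] else [::].
Fixpoint back_word n : word 4 :=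
  if n is m.+1 then [:: stepl (odd m)] ++ back_word m else [::].

(* All four generators act as involutions, so inverse letters are not needed:
   [path_word n] conjugates the [mark] at position [n] to position 0, and
   [comm_word n] acts as the commutator of this conjugate with [base]. *)
Definition probe n : word 4 :=
  path_word n ++ [:: mark] ++ back_word n ++ [:: base].
Definition comm_word n : word 4 := probe n ++ probe n.

Section Eval.
Variable c : pred nat.
Local Notation ev := (acts (fibre_act c)).

Lemma fibre_stepl e x : fibre_act c (stepl e) x = (walk e x.1, x.2).
Proof. by rewrite /fibre_act /= inordK; case: e. Qed.

Lemma path_wordK n : cancel (ev (path_word n)) (ev (back_word n)).
Proof.
elim: n => //= n IH x; rewrite acts_cat /= !fibre_stepl /= walkK.
by rewrite -surjective_pairing IH.
Qed.

Lemma path_word_fst n y r : ev (path_word n) (y, r) =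
  ((ev (path_word n) (y, 0)).1, r).
Proof. by elim: n => //= n; rewrite !acts_cat /= !fibre_stepl /= => ->. Qed.

Lemma path_word0 n r : ev (path_word n) (0, r) = (n, r).
Proof.
elim: n => //= n IH; rewrite acts_cat IH /= fibre_stepl /= /walk.
by rewrite addbb.
Qed.

(** The conjugate of [mark] by the path returns to its starting position. From position 0 the path
    leads to [n], and only there does [base] act as well. *)
Lemma ev_probe n y r : ev (probe n) (y, r) =
  if y == 0 then (0, transp 1 (if c n then transp 0 r else r))
  else (y, if c (ev (path_word n) (y, 0)).1 then transp 0 r else r).
Proof.
have markE x : fibre_act c mark x = (x.1, if c x.1 then transp 0 x.2 else x.2).
  by rewrite /fibre_act /= inordK.
rewrite /probe !acts_cat path_word_fst.
set p := (ev (path_word n) (y, 0)).1.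
have -> s : ev [:: mark] (p, s) =
    ev (path_word n) (y, if c p then transp 0 s else s).
  by rewrite path_word_fst /= markE.
rewrite path_wordK /= /fibre_act /=; case: eqP => // y0.
by rewrite /p y0 path_word0.
Qed.

(** [comm_word n] squares [probe n], which acts on the register as an involution or the identity,
    except at position 0 when [c n] holds. There it is a 3-cycle, whose square is nontrivial. *)
Lemma ev_comm_word n y r : ev (comm_word n) (y, r) =
  if (y == 0) && c n then (0, transp 1 (transp 0 (transp 1 (transp 0 r))))
  else (y, r).
Proof.
rewrite /comm_word acts_cat !ev_probe; case: eqP => [->|/eqP/negbTE y0] /=.
  by rewrite ev_probe /=; case: (c n); rewrite ?transpK.
by rewrite ev_probe y0; case: (c _); rewrite ?transpK.
Qed.
End Eval.
End Fibres.

(** * Computable functions *)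

Definition tcomputable k (f : k.-tuple nat -> nat) : Prop :=
  exists c : murec k, forall v r, murec_eval c v r <-> f v = r.

Lemma tcomputable_proj k (i : 'I_k) : tcomputable (fun v => tnth v i).
Proof. by exists (MProj i) => v r; split=> /= ->. Qed.

Lemma tcomputable_comp k l (h : l.-tuple nat -> nat)
    (g : 'I_l -> k.-tuple nat -> nat) :
  tcomputable h -> (forall i, tcomputable (g i)) ->
  tcomputable (fun v => h [tuple g i v | i < l]).
Proof.
move=> [ch hP] /fin_all_exists[cg gP]; exists (MComp ch cg) => v r /=.
split=> [[w wP]|hr].
  suff -> : [tuple g i v | i < l] = w by move/hP.
  by apply: eq_from_tnth => i; rewrite tnth_mktuple; apply/gP.
exists [tuple g i v | i < l] => [i|]; last exact/hP.
by rewrite tnth_mktuple; apply/gP.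
Qed.

Lemma tcomputable_app1 k h f : computable1 h -> @tcomputable k f ->
  tcomputable (fun v => h (f v)).
Proof.
move=> [c hP] fC.
have hC : tcomputable (fun v : 1.-tuple nat => h (thead v)).
  by exists c => v r; case/tupleP: v => x v; rewrite tuple0 theadE; apply: hP.
have := tcomputable_comp hC (fun i : 'I_1 => fC).
congr tcomputable; apply/funext => v.
by rewrite /thead tnth_mktuple.
Qed.

Lemma tcomputable_app2 k h f g : computable2 h -> @tcomputable k f ->
  tcomputable g -> tcomputable (fun v => h (f v) (g v)).
Proof.
move=> [c hP] fC gC.
have hC : tcomputable
    (fun v : 2.-tuple nat => h (tnth v ord0) (tnth v (inord 1))).
  exists c => v r; case/tupleP: v => x v; case/tupleP: v => y v.
  by rewrite tuple0 tnth0 !(tnth_nth 0) inordK //; apply: hP.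
pose F (i : 'I_2) := if i == ord0 then f else g.
have FC i : tcomputable (F i) by rewrite /F; case: ifP.
have := tcomputable_comp hC FC; congr tcomputable; apply/funext => v.
by rewrite !tnth_mktuple /F -!val_eqE /= inordK.
Qed.

Lemma tcomputable_app3 k h f g e : computable3 h -> @tcomputable k f ->
  tcomputable g -> tcomputable e -> tcomputable (fun v => h (f v) (g v) (e v)).
Proof.
move=> [c hP] fC gC eC.
have hC : tcomputable (fun v : 3.-tuple nat =>
    h (tnth v ord0) (tnth v (inord 1)) (tnth v (inord 2))).
  exists c => v r; case/tupleP: v => x v; case/tupleP: v => y v.
  case/tupleP: v => z v; rewrite tuple0 tnth0 !(tnth_nth 0) !inordK //.
  exact: hP.
pose F (i : 'I_3) :=
  if i == 0 :> nat then f else if i == 1 :> nat then g else e.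
have FC i : tcomputable (F i) by rewrite /F; do 2?case: ifP.
have := tcomputable_comp hC FC; congr tcomputable; apply/funext => v.
by rewrite !tnth_mktuple /F /= !inordK.
Qed.

Lemma computable1P f :
  computable1 f <-> tcomputable (fun v : 1.-tuple nat => f (thead v)).
Proof.
split=> [fC|[c fP]]; first exact: tcomputable_app1 fC (tcomputable_proj _).
by exists c => x r; rewrite fP theadE.
Qed.

Section Computable.
Variables (pairing : nat -> nat -> nat) (p1 p2 : nat -> nat).
Hypothesis pairingC : computable2 pairing.
Hypotheses (p1C : computable1 p1) (p2C : computable1 p2).
Hypothesis pairingK1 : forall n m, p1 (pairing n m) = n.
Hypothesis pairingK2 : forall n m, p2 (pairing n m) = m.

Lemma computable1_id : computable1 id.
Proof. exact/computable1P/tcomputable_proj. Qed.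

Lemma computable1_comp f g :
  computable1 f -> computable1 g -> computable1 (fun z => f (g z)).
Proof. by move=> fC /computable1P gC; apply/computable1P/tcomputable_app1. Qed.

Lemma computable1_app2 h f g : computable2 h -> computable1 f ->
  computable1 g -> computable1 (fun z => h (f z) (g z)).
Proof.
move=> hC /computable1P fC /computable1P gC.
exact/computable1P/tcomputable_app2.
Qed.

Lemma computable1_app3 h f g e : computable3 h -> computable1 f ->
  computable1 g -> computable1 e -> computable1 (fun z => h (f z) (g z) (e z)).
Proof.
move=> hC /computable1P fC /computable1P gC /computable1P eC.
exact/computable1P/tcomputable_app3.
Qed.

Lemma computable1_succ f : computable1 f -> computable1 (fun z => (f z).+1).
Proof.
by apply: computable1_comp; exists MSucc => x r; split=> /= ->.
Qed.

Lemma computable1_const n : computable1 (fun _ => n).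
Proof.
elim: n => [|n IH]; last exact: computable1_succ IH.
by exists (MZero 1) => x r; split=> /= ->.
Qed.

Lemma computable1_fst f : computable1 f -> computable1 (fun z => p1 (f z)).
Proof. exact: computable1_comp. Qed.

Lemma computable1_snd f : computable1 f -> computable1 (fun z => p2 (f z)).
Proof. exact: computable1_comp. Qed.

Lemma computable1_pairing f g : computable1 f -> computable1 g ->
  computable1 (fun z => pairing (f z) (g z)).
Proof. exact: computable1_app2. Qed.

(* A function of several arguments is handled as a function of one argument,
   a context from which the arguments are extracted by [p1] and [p2]. *)
Lemma computable2P h :
  computable2 h <-> computable1 (fun z => h (p1 z) (p2 z)).
Proof.
split=> [hC|hC]; first exact: computable1_app2.
have [c cP] := tcomputable_app1 hC (tcomputable_app2 pairingC
  (tcomputable_proj (ord0 : 'I_2)) (tcomputable_proj ord_max)).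
exists c => x y r.
by rewrite cP pairingK1 pairingK2.
Qed.

(** Primitive recursion with the context [z] as parameter; the arithmetic below is derived from
    it. *)
Lemma computable1_iteri n b s : computable1 n -> computable1 b ->
    computable1 (fun y => s (p1 y) (p1 (p2 y)) (p2 (p2 y))) ->
  computable1 (fun z => iteri (n z) (fun m acc => s m acc z) (b z)).
Proof.
move=> nC [cb bP] sC.
suff rC : computable2 (fun n z => iteri n (fun m acc => s m acc z) (b z)).
  exact: (computable1_app2 rC nC computable1_id).
(* The program of the step takes three arguments, which are packed into one for the unary hypothesis
   [sC]. *)
have [cs sP] := tcomputable_app1 sC (tcomputable_app2 pairingC
  (tcomputable_proj (ord0 : 'I_3)) (tcomputable_app2 pairingC
    (tcomputable_proj (Ordinal (isT : 1 < 3))) (tcomputable_proj ord_max))).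
exists (MRec cb cs) => m z r.
have -> : murec_eval (MRec cb cs) [tuple m; z] r =
   primrec_rel (murec_eval cb) (murec_eval cs) [tuple z] m r.
  by rewrite /=; congr (primrec_rel _ _ _ _ _); apply/val_inj.
elim: m r => [|m IH] r; first exact: bP.
rewrite [primrec_rel _ _ _ _ _]/=.
split=> [[a /IH <-]|sr]; first by rewrite sP !(pairingK1, pairingK2).
by eexists; [exact/IH|rewrite sP !(pairingK1, pairingK2)].
Qed.

(** A conditional is an iteration of length 0 or 1. *)
Lemma computable1_if (b : nat -> bool) f g :
  computable1 (fun z => b z) -> computable1 f -> computable1 g ->
  computable1 (fun z => if b z then f z else g z).
Proof.
move=> bC fC gC.
have -> : (fun z => if b z then f z else g z) =
    (fun z => iteri (b z) (fun _ _ => f z) (g z)).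
  by apply/funext => z; case: (b z).
apply: (computable1_iteri (s := fun _ _ z => f z)) => //.
by do 2?apply: computable1_comp => //.
Qed.

Lemma computable1_pred f : computable1 f -> computable1 (fun z => (f z).-1).
Proof.
move=> fC.
have -> : (fun z => (f z).-1) = fun z => iteri (f z) (fun m _ => m) 0.
  by apply/funext => z; case: (f z).
apply: (computable1_iteri (s := fun m _ _ => m)) => //.
exact: computable1_const.
Qed.

Lemma computable1_add f g : computable1 f -> computable1 g ->
  computable1 (fun z => f z + g z).
Proof.
move=> fC gC.
have -> : (fun z => f z + g z) = fun z => iteri (f z) (fun _ a => a.+1) (g z).
  by apply/funext => z; elim: (f z) => //= n <-.
apply: (computable1_iteri (s := fun _ a _ => a.+1)) => //.
exact/computable1_succ/computable1_comp.
Qed.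

Lemma computable1_sub f g : computable1 f -> computable1 g ->
  computable1 (fun z => f z - g z).
Proof.
move=> fC gC.
have -> : (fun z => f z - g z) = fun z => iteri (g z) (fun _ a => a.-1) (f z).
  apply/funext => z; elim: (g z) => [|n IH] /=; first by rewrite subn0.
  by rewrite -IH subnS.
apply: (computable1_iteri (s := fun _ a _ => a.-1)) => //.
exact/computable1_pred/computable1_comp.
Qed.

Lemma computable1_eq0 f : computable1 f -> computable1 (fun z => f z == 0).
Proof.
move=> fC; have -> : (fun z => nat_of_bool (f z == 0)) = fun z => 1 - f z.
  by apply/funext => z; case: (f z).
by apply: computable1_sub => //; apply: computable1_const.
Qed.

Lemma computable1_leq f g : computable1 f -> computable1 g ->
  computable1 (fun z => f z <= g z).
Proof. by move=> fC gC; apply/computable1_eq0/computable1_sub. Qed.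

Lemma computable1_eq f g : computable1 f -> computable1 g ->
  computable1 (fun z => f z == g z).
Proof.
move=> fC gC; have -> : (fun z => nat_of_bool (f z == g z)) =
    fun z => (f z - g z + (g z - f z) == 0).
  by apply/funext => z; rewrite addn_eq0 !subn_eq0 -eqn_leq.
by apply/computable1_eq0/computable1_add; apply: computable1_sub.
Qed.

Lemma computable1_neg (b : nat -> bool) : computable1 (fun z => b z) ->
  computable1 (fun z => ~~ b z).
Proof.
move=> bC; have -> : (fun z => nat_of_bool (~~ b z)) = fun z => b z == 0 :> nat.
  by apply/funext => z; case: (b z).
exact: computable1_eq0.
Qed.

Lemma computable1_and (b c : nat -> bool) : computable1 (fun z => b z) ->
  computable1 (fun z => c z) -> computable1 (fun z => b z && c z).
Proof.
move=> bC cC; have -> : (fun z => nat_of_bool (b z && c z)) =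
    fun z => if b z then nat_of_bool (c z) else 0.
  by apply/funext => z; case: (b z).
by apply: computable1_if => //; apply: computable1_const.
Qed.

Lemma computable1_or (b c : nat -> bool) : computable1 (fun z => b z) ->
  computable1 (fun z => c z) -> computable1 (fun z => b z || c z).
Proof.
move=> bC cC; have -> : (fun z => nat_of_bool (b z || c z)) =
    fun z => if b z then 1 else nat_of_bool (c z).
  by apply/funext => z; case: (b z).
by apply: computable1_if => //; apply: computable1_const.
Qed.

Lemma computable1_odd f : computable1 f -> computable1 (fun z => odd (f z)).
Proof.
move=> fC; have -> : (fun z => nat_of_bool (odd (f z))) =
    fun z => iteri (f z) (fun _ a => nat_of_bool (a == 0)) 0.
  by apply/funext => z; elim: (f z) => //= n <-; case: odd.
apply: (computable1_iteri (s := fun _ a _ => nat_of_bool (a == 0))) => //.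
  exact: computable1_const.
exact/computable1_eq0/computable1_comp.
Qed.

Lemma computable1_half f : computable1 f -> computable1 (fun z => (f z)./2).
Proof.
move=> fC; have -> : (fun z => (f z)./2) =
    fun z => iteri (f z) (fun m a => odd m + a) 0.
  by apply/funext => z; elim: (f z) => //= n <-; rewrite uphalf_half.
apply: (computable1_iteri (s := fun m a _ => odd m + a)) => //.
  exact: computable1_const.
apply: computable1_add; last exact: computable1_comp.
exact: computable1_odd.
Qed.

Lemma computable1_all (P : nat -> nat -> bool) n : computable1 n ->
    computable1 (fun y => P (p1 y) (p2 y)) ->
  computable1 (fun z => all (fun j => P j z) (iota 0 (n z))).
Proof.
move=> nC PC; have -> : (fun z => nat_of_bool (all (P^~ z) (iota 0 (n z)))) =
    fun z => iteri (n z) (fun j a => nat_of_bool ((a == 1) && P j z)) 1.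
  apply/funext => z; elim: (n z) => // m IH.
  by rewrite iteriS -IH -[m.+1]addn1 iotaD all_cat /= andbT; case: (all _ _).
apply: (computable1_iteri
  (s := fun j a z => nat_of_bool ((a == 1) && P j z))) => //.
  exact: computable1_const.
apply: computable1_and.
  apply: computable1_eq; last exact: computable1_const.
  exact: computable1_comp.
have -> : (fun y => nat_of_bool (P (p1 y) (p2 (p2 y)))) =
    fun y => (fun x => nat_of_bool (P (p1 x) (p2 x)))
      (pairing (p1 y) (p2 (p2 y))).
  by apply/funext => y; rewrite pairingK1 pairingK2.
apply: (computable1_comp PC); apply: computable1_pairing => //.
exact: computable1_comp.
Qed.

(** Minimisation is total when a solution always exists. Operations on words and on finite sets are
    computed this way, by searching for a code that meets a decidable specification. *)
Lemma computable1_search (P : nat -> nat -> bool) :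
    computable1 (fun y => P (p1 y) (p2 y)) -> (forall z, exists n, P n z) ->
  exists2 f, computable1 f & forall z, P (f z) z.
Proof.
move=> PC exP; have PN : computable2 (fun n z => nat_of_bool (~~ P n z)).
  exact/computable2P/computable1_neg.
exists (fun z => ex_minn (exP z)) => [|z]; last by case: ex_minnP.
have [c cP] := PN; exists (MMin c) => x r.
have -> : murec_eval (MMin c) [tuple x] r <->
    murec_eval c [tuple r; x] 0 /\
    forall m, m < r -> exists y, murec_eval c [tuple m; x] y.+1.
  rewrite /=; split=> -[H1 H2]; (split; [|move=> m /H2[y H]; exists y]).
  - by move: H1; congr (murec_eval _ _ _); apply/val_inj.
  - by move: H; congr (murec_eval _ _ _); apply/val_inj.
  - by move: H1; congr (murec_eval _ _ _); apply/val_inj.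
  - by move: H; congr (murec_eval _ _ _); apply/val_inj.
case: ex_minnP => n Pn n_min; rewrite cP; split=> [[Pr rmin]|<-].
  have {}Pr : P r x by move: Pr; case: (P r x).
  apply/eqP; rewrite eqn_leq n_min //= leqNgt; apply/negP => /rmin[y /cP].
  by rewrite Pn.
split=> [|m mn]; first by rewrite Pn.
exists 0; apply/cP; case Pm: (P m x) => //.
by move/n_min: Pm; rewrite leqNgt mn.
Qed.

(** Follows the syntax of a function of one context. Local functions are recognised through
    hypotheses stating their computability, so these must be in the context beforehand. *)
Ltac computability := cbv beta; repeat first
  [ assumption
  | exact: computable1_id
  | exact: computable1_const
  | match goal with
    | H : computable1 ?h |- computable1 (fun z => ?h (@?f z)) =>
        apply: (computable1_comp H)
    | H : computable2 ?h |- computable1 (fun z => ?h (@?f z) (@?g z)) =>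
        apply: (computable1_app2 H)
    | H : computable2 (fun x y => nat_of_bool (?h x y)) |-
        computable1 (fun z => nat_of_bool (?h (@?f z) (@?g z))) =>
        refine (@computable1_app2 _ f g H _ _)
    | H : computable3 ?h |-
        computable1 (fun z => ?h (@?f z) (@?g z) (@?e z)) =>
        apply: (computable1_app3 H)
    end
  | apply: computable1_succ
  | apply: computable1_fst
  | apply: computable1_snd
  | apply: computable1_pairing
  | apply: computable1_pred
  | apply: computable1_add
  | apply: computable1_sub
  | apply: computable1_half
  | apply: computable1_neg
  | apply: computable1_and
  | apply: computable1_or
  | apply: computable1_leq
  | apply: computable1_eq
  | apply: computable1_odd
  | match goal with
    | |- computable1 (fun z => if @?b z then _ else _) => apply: computable1_if
    end ].

Lemma computable1_foldr_pairing I (s : seq I) (F : I -> nat -> nat) :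
  (forall i, computable1 (F i)) ->
  computable1 (fun z => foldr pairing 0 [seq F i z | i <- s]).
Proof.
by move=> FC; elim: s => [|i s IH] /=; computability; apply: FC.
Qed.

Lemma computable1_all_seq I (s : seq I) (P : I -> nat -> bool) :
  (forall i, computable1 (fun z => P i z)) ->
  computable1 (fun z => all (P^~ z) s).
Proof.
by move=> PC; elim: s => [|i s IH] /=; computability; apply: PC.
Qed.

(* [st t x] is [r.+1] if the computation on the tuple coded by [x] is seen to
   halt with result [r] at stage [t], and [0] otherwise. *)
Definition stages k (c : murec k) (st : nat -> nat -> nat) : Prop :=
  [/\ computable2 st,
      forall t t' x r, t <= t' -> st t x = r.+1 -> st t' x = r.+1
    & forall v r, murec_eval c v r <->
        exists t, st t (foldr pairing 0 (v : k.-tuple nat)) = r.+1].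

Lemma stages_proj k (i : 'I_k) : exists st, stages (MProj i) st.
Proof.
exists (fun _ x => (p1 (iter i p2 x)).+1); split=> [||v r].
- apply/computable2P/computable1_succ/computable1_fst.
  by elim: (nat_of_ord i) => [|n IH] /=; computability.
- by [].
have -> : p1 (iter i p2 (foldr pairing 0 v)) = tnth v i.
  rewrite (tnth_nth 0); case: v i => v /= /eqP vk [i /=].
  rewrite -vk => {k vk}; elim: i v => [|i IH] [|x v] //= iv.
  by rewrite -iterS iterSr pairingK2 IH.
by split=> /= [->|[_ [->]]] //; exists 0.
Qed.

(** At stage [t] all inner computations must have halted, and the outer one is then run on their
    results for [t] stages. *)
Lemma stages_comp k l (f : murec l) (g : 'I_l -> murec k) :
    (exists st, stages f st) -> (forall i, exists st, stages (g i) st) ->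
  exists st, stages (MComp f g) st.
Proof.
move=> [sf [sfC sf_mono sfP]] /fin_all_exists[sg sgP].
pose w t x := [seq (sg i t x).-1 | i <- enum 'I_l].
exists (fun t x => if all (fun i => 0 < sg i t x) (enum 'I_l)
                   then sf t (foldr pairing 0 (w t x)) else 0).
have sgC i : computable2 (sg i) by case: (sgP i).
have sg_mono i t t' x : t <= t' -> 0 < sg i t x -> sg i t' x = sg i t x.
  case: (sgP i) => _ sg_mono _ tt'; case E: (sg i t x) => [//|r] _.
  exact: sg_mono E.
split=> [|t t' x r tt'|v r].
- apply/computable2P; computability.
    apply: (computable1_all_seq _ (P := fun i z => 0 < sg i (p1 z) (p2 z))) => i.
    by have := sgC i => ?; computability.
  apply: (computable1_foldr_pairing _
    (F := fun i z => (sg i (p1 z) (p2 z)).-1)) => i.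
  by have := sgC i => ?; computability.
- case: ifP => // /allP sg0; have sgE i : sg i t' x = sg i t x.
    by apply/(sg_mono _ _ _ _ tt')/sg0; rewrite mem_enum.
  rewrite /w (eq_map (fun i => congr1 predn (sgE i))).
  rewrite (eq_all (fun i => congr1 (leq 1) (sgE i))).
  by move/allP: sg0 => ->; apply: sf_mono.
split=> /= [[u gu /sfP[t ft]]|[t]].
  have /fin_all_exists[tg tgP] i : exists t,
      sg i t (foldr pairing 0 v) = (tnth u i).+1.
    by case: (sgP i) => _ _ <-.
  (* A stage late enough for the outer computation and for every inner one. *)
  pose T := maxn t (\max_i tg i); exists T.
  have sgT i : sg i T (foldr pairing 0 v) = (tnth u i).+1.
    rewrite -tgP; apply: sg_mono; last by rewrite tgP.
    by rewrite /T leq_max (bigmax_sup i) ?orbT.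
  rewrite (eq_all (a2 := predT)) ?all_predT => [|i]; last by rewrite sgT.
  rewrite /w (eq_map (fun i => congr1 predn (sgT i))) /= map_tnth_enum.
  by apply: sf_mono ft; rewrite leq_maxl.
case: ifP => // /allP sg0 sfr.
exists [tuple (sg i t (foldr pairing 0 v)).-1 | i < l] => [i|].
  case: (sgP i) => _ _ ->; exists t.
  by rewrite tnth_mktuple prednK // sg0 ?mem_enum.
by apply/sfP; exists t.
Qed.

Lemma stages_rec k (f : murec k) (g : murec k.+2) :
    (exists st, stages f st) -> (exists st, stages g st) ->
  exists st, stages (MRec f g) st.
Proof.
move=> [sf [sfC sf_mono sfP]] [sg [sgC sg_mono sgP]].
(* The accumulator is 0 while the value is unknown and the successor of the value otherwise, hence
   [a.-1]. *)
pose R n t x := iteri n (fun m a : nat =>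
  if a == 0 then 0 else sg t (pairing m (pairing a.-1 x))) (sf t x).
have RS n t x s : R n t x = s.+1 ->
  R n.+1 t x = sg t (pairing n (pairing s x)) by rewrite /R /= => ->.
have R0 n t x : R n t x = 0 -> R n.+1 t x = 0 by rewrite /R /= => ->.
have R00 t x : R 0 t x = sf t x by [].
have RC : computable2 (fun t x => R (p1 x) t (p2 x)).
  apply/computable2P; apply: (computable1_iteri (s := fun m a z =>
    if a == 0 then 0 else sg (p1 z) (pairing m (pairing a.-1 (p2 (p2 z))))));
  by computability.
(* Generalising [R] hides its body and keeps only the recursion equations. *)
move: R RC RS R0 R00 => R RC RS R0 R00.
have R_mono n t t' x r : t <= t' -> R n t x = r.+1 -> R n t' x = r.+1.
  move=> tt'; elim: n r => [|n IH] r; first by rewrite !R00; apply: sf_mono.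
  case E: (R n t x) => [|s]; first by rewrite (R0 _ _ _ E).
  by rewrite (RS _ _ _ _ E) (RS _ _ _ _ (IH _ E)); apply: sg_mono.
exists (fun t x => R (p1 x) t (p2 x)); split=> [|t t' x r|v r].
- exact: RC.
- exact: R_mono.
case/tupleP: v => n v /=; rewrite pairingK1 pairingK2 theadE.
have -> : behead_tuple [tuple of n :: v] = v by apply/val_inj.
elim: n r => [|n IH] r.
  by rewrite /= sfP; split=> -[t tr]; exists t; rewrite ?R00 // -R00.
split=> /= [[s /IH[t Rt] /sgP[t' /= gt]]|[t]].
  exists (maxn t t'); rewrite (RS _ _ _ s).
    by apply: sg_mono gt; rewrite leq_maxr.
  exact: R_mono (leq_maxl t t') Rt.
case E: (R n t (foldr pairing 0 v)) => [|s]; first by rewrite (R0 _ _ _ E).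
rewrite (RS _ _ _ _ E) => gr.
by exists s; [apply/IH; exists t | apply/sgP; exists t].
Qed.

Lemma stages_min k (f : murec k.+1) :
  (exists st, stages f st) -> exists st, stages (MMin f) st.
Proof.
move=> [sf [sfC sf_mono sfP]].
(* State of the search for a zero: [0] while it runs, [1] when it is blocked by
   an undefined value, [r.+2] when it has found [r]. *)
pose S n t x := iteri n (fun m a : nat => if a == 0 then
    if sf t (pairing m x) == 0 then 1
    else if sf t (pairing m x) == 1 then m.+2 else 0 else a) 0.
have S0 n t x :
    S n t x = 0 <-> forall m, m < n -> exists y, sf t (pairing m x) = y.+2.
  elim: n => [|n IH] //=; rewrite -/(S n t x); split.
    case: eqP => [/IH S0|//] ; case E: (sf t (pairing n x)) => [|[|y]] //= _ m.
    by rewrite ltnS leq_eqVlt => /predU1P[->|/S0 //]; exists y.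
  move=> H; have /IH -> : forall m, m < n -> exists y, sf t (pairing m x) = y.+2.
    by move=> m mn; apply: H; rewrite ltnS ltnW.
  by have [y ->] := H n (leqnn _).
have Sr n t x r : S n t x = r.+2 <->
    [/\ r < n, S r t x = 0 & sf t (pairing r x) = 1].
  elim: n => [|n IH] /=; first by split=> // -[].
  rewrite -/(S n t x); split.
    case: eqP => [Sn|_].
      case E: (sf t (pairing n x)) => [|[|y]] //= -[<-].
      by rewrite Sn E.
    by move/IH => [rn -> ->]; split=> //; apply: ltnW.
  move=> [rn Sr fr]; move: rn; rewrite ltnS leq_eqVlt => /predU1P[rn|rn].
    by rewrite -rn Sr fr.
  by have /IH -> : [/\ r < n, S r t x = 0 & sf t (pairing r x) = 1].
(* The predecessor sends both the running state 0 and the blocked state 1 to 0, and [r.+2] to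
   [r.+1]. The stage also bounds the length of the search. *)
exists (fun t x => (S t t x).-1); split=> [|t t' x r tt'|v r].
- apply/computable2P/computable1_pred.
  apply: (computable1_iteri (s := fun m a z => if a == 0 then
    if sf (p1 z) (pairing m (p2 z)) == 0 then 1
    else if sf (p1 z) (pairing m (p2 z)) == 1 then m.+2 else 0 else a));
  by computability.
- move=> E; have /Sr[rt /S0 Srt fr] : S t t x = r.+2.
    by rewrite -E prednK //; move: E; case: (S t t x).
  have /Sr -> : [/\ r < t', S r t' x = 0 & sf t' (pairing r x) = 1] => //.
  split; [exact: leq_trans tt' | apply/S0 => m /Srt[y] | exact: sf_mono fr].
  by move=> /(sf_mono _ _ _ _ tt'); exists y.
have fP m y : murec_eval f [tuple of m :: v] y <->
    exists t, sf t (pairing m (foldr pairing 0 v)) = y.+1 by apply: sfP.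
split=> /= [[/fP[t ft] f_lt]|[t E]].
  have [T TP] : exists T, forall m, m < r ->
      exists y, sf T (pairing m (foldr pairing 0 v)) = y.+2.
    elim: r f_lt {ft} => [|r IH] f_lt; first by exists 0.
    have [m mr|T TP] := IH; first by apply: f_lt; rewrite ltnW.
    have [y /fP[T' T'P]] := f_lt r (leqnn _); exists (maxn T T') => m.
    rewrite ltnS leq_eqVlt => /predU1P[->|/TP[{T'P}y yP]]; exists y.
      exact: sf_mono (leq_maxr _ _) T'P.
    exact: sf_mono (leq_maxl _ _) yP.
  pose U := maxn r.+1 (maxn t T); exists U.
  have /Sr -> // : [/\ r < U, S r U (foldr pairing 0 v) = 0
    & sf U (pairing r (foldr pairing 0 v)) = 1].
  split; first by rewrite leq_maxl.
    apply/S0 => m /TP[y yP]; exists y; apply: sf_mono yP.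
    by rewrite !leq_max leqnn !orbT.
  by apply: sf_mono ft; rewrite !leq_max leqnn !orbT.
have /Sr[rt /S0 Srt fr] : S t t (foldr pairing 0 v) = r.+2.
  by rewrite -E prednK //; move: E; case: (S t t _).
by split=> [|m /Srt[y yP]]; [|exists y]; apply/fP; exists t.
Qed.

(** A form of Kleene's normal form theorem: halting of a fixed program becomes the existence of a
    stage satisfying a decidable condition. *)
Lemma murec_stages k (c : murec k) : exists st, stages c st.
Proof.
elim: c => {k} [k||k i|k l f IHf g IHg|k f IHf g IHg|k f IHf].
- exists (fun _ _ => 1); split=> [||v r] //.
    exact/computable2P/computable1_const.
  by split=> /= [->|[_ [->]]] //; exists 0.
- exists (fun _ x => (p1 x).+2); split=> [||v r] //.
    by apply/computable2P; computability.
  case/tupleP: v => x v /=; rewrite theadE pairingK1.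
  by split=> [->|[_ [->]]] //; exists 0.
- exact: stages_proj.
- exact: stages_comp.
- exact: stages_rec.
- exact: stages_min.
Qed.

(** * Semidecidable predicates *)

Definition semidecidable (P : nat -> Prop) : Prop :=
  exists2 Q : nat -> nat -> bool, computable2 (fun z t => Q z t) &
    forall z, P z <-> exists t, Q z t.

Lemma eq_semidecidable P Q : (forall z, P z <-> Q z) ->
  semidecidable P -> semidecidable Q.
Proof. by move=> PQ; have -> : P = Q by apply/funext => z; apply/propext. Qed.

Lemma semidecidable_decidable (b : nat -> bool) :
  computable1 (fun z => b z) -> semidecidable b.
Proof.
move=> bC; exists (fun z _ => b z) => [|z]; last by split=> [|[]] //; exists 0.
by apply/computable2P; apply: (computable1_comp bC).
Qed.

Lemma semidecidable_comp P f :
  semidecidable P -> computable1 f -> semidecidable (fun z => P (f z)).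
Proof.
move=> [Q QC QP] fC; exists (fun z => Q (f z)) => //.
by apply/computable2P; computability.
Qed.

Lemma semidecidable_and P P' : semidecidable P -> semidecidable P' ->
  semidecidable (fun z => P z /\ P' z).
Proof.
move=> [Q QC QP] [Q' Q'C Q'P].
exists (fun z t => Q z (p1 t) && Q' z (p2 t)) => [|z].
  by apply/computable2P; computability.
rewrite QP Q'P; split=> [[[t tP] [t' t'P]]|[t /andP[tP t'P]]].
  by exists (pairing t t'); rewrite pairingK1 pairingK2 tP.
by split; [exists (p1 t) | exists (p2 t)].
Qed.

Lemma semidecidable_or P P' : semidecidable P -> semidecidable P' ->
  semidecidable (fun z => P z \/ P' z).
Proof.
move=> [Q QC QP] [Q' Q'C Q'P]; exists (fun z t => Q z t || Q' z t) => [|z].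
  by apply/computable2P; computability.
rewrite QP Q'P; split=> [[|] [t tP]|[t /orP[]]].
- by exists t; rewrite tP.
- by exists t; rewrite tP orbT.
- by left; exists t.
- by right; exists t.
Qed.

Lemma semidecidable_ex (P : nat -> nat -> Prop) :
  semidecidable (fun y => P (p1 y) (p2 y)) ->
  semidecidable (fun z => exists n, P n z).
Proof.
move=> [Q QC QP]; exists (fun z t => Q (pairing (p1 t) z) (p2 t)) => [|z].
  by apply/computable2P; computability.
split=> [[n]|[t tP]].
  have := QP (pairing n z); rewrite pairingK1 pairingK2 => -> [t tP].
  by exists (pairing n t); rewrite pairingK1 pairingK2.
exists (p1 t); have := QP (pairing (p1 t) z).
by rewrite pairingK1 pairingK2 => ->; exists (p2 t).
Qed.

(** With a monotone test, finitely many witnesses have a common stage; this is what bounded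
    quantification needs. *)
Lemma semidecidable_mono P : semidecidable P ->
  exists Q : nat -> nat -> bool, [/\ computable2 (fun z t => Q z t),
    forall z t t', t <= t' -> Q z t -> Q z t'
    & forall z, P z <-> exists t, Q z t].
Proof.
move=> [Q QC QP].
have QE z t : has (Q z) (iota 0 t) <-> exists2 s, s < t & Q z s.
  by split=> [/hasP[s]|[s st Qs]]; [rewrite mem_iota; exists s
    | apply/hasP; exists s; rewrite ?mem_iota].
exists (fun z t => has (Q z) (iota 0 t)); split=> [|z t t' tt'|z].
- have -> : (fun z t => nat_of_bool (has (Q z) (iota 0 t))) =
      fun z t => nat_of_bool (~~ all (fun s => ~~ Q z s) (iota 0 t)).
    by do 2 apply/funext => ?; rewrite -has_predC; congr (nat_of_bool _);
       apply: eq_has => s /=; rewrite negbK.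
  apply/computable2P/computable1_neg.
  by apply: (computable1_all (P := fun s z => ~~ Q (p1 z) s)); computability.
- move=> /QE[s st Qs]; apply/QE; exists s => //.
  exact: leq_trans tt'.
rewrite QP; split=> [[t tP]|[t /QE[s _ sP]]]; last by exists s.
by exists t.+1; apply/QE; exists t.
Qed.

Lemma semidecidable_forall_lt (P : nat -> nat -> Prop) n :
    semidecidable (fun y => P (p1 y) (p2 y)) -> computable1 n ->
  semidecidable (fun z => forall j, j < n z -> P j z).
Proof.
move=> /semidecidable_mono[Q [QC Qmono QP]] nC.
have PE j z : P j z <-> exists t, Q (pairing j z) t.
  by rewrite -QP pairingK1 pairingK2.
exists (fun z t => all (fun j => Q (pairing j z) t) (iota 0 (n z))) => [|z].
  apply/computable2P; apply: (computable1_all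
    (P := fun j z => Q (pairing j (p1 z)) (p2 z))); by computability.
split=> [|[t /allP tP] j jn]; last first.
  by apply/PE; exists t; apply: tP; rewrite mem_iota.
elim: (n z) => [|m IH] mP; first by exists 0.
have [j jm|t tP] := IH; first by apply/mP/ltnW.
have /PE[t' t'P] := mP m (leqnn _); exists (maxn t t').
rewrite -[m.+1]addn1 iotaD all_cat /= andbT add0n.
rewrite (Qmono _ _ _ _ t'P) ?leq_maxr // andbT; apply: sub_all tP => j; apply/Qmono/leq_maxl.
Qed.

(** A whole chain is coded by one integer, and checking that it is a chain is a bounded
    quantification over its links. *)
Lemma semidecidable_connect (R : nat -> nat -> nat -> Prop) :
  semidecidable (fun y => R (p1 y) (p1 (p2 y)) (p2 (p2 y))) ->
  semidecidable (fun y =>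
    clos_refl_trans nat (R (p1 y)) (p1 (p2 y)) (p2 (p2 y))).
Proof.
move=> RC.
(* [e j t] is entry [j] of the sequence that [t] codes by iterated pairing. *)
have [e [eC e0 eS]] : exists e : nat -> nat -> nat, [/\ computable2 e,
    forall t, e 0 t = p1 t & forall j t, e j.+1 t = e j (p2 t)].
  exists (fun j t => p1 (iter j p2 t)).
  split=> // [|j t]; last by rewrite iterSr.
  apply/computable2P/computable1_fst.
  have -> : (fun z => iter (p1 z) p2 (p2 z)) =
      fun z => iteri (p1 z) (fun _ a => p2 a) (p2 z).
    by apply/funext => z; elim: (p1 z) => //= n ->.
  by apply: (computable1_iteri (s := fun _ a _ => p2 a)); computability.
pose P n t y := [/\ e 0 t == p1 (p2 y), e n t == p2 (p2 y)
  & forall j, j < n -> R (p1 y) (e j t) (e j.+1 t)].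
apply: (@eq_semidecidable (fun y => exists t, exists n, P n t y)).
  move=> y; have -> : clos_refl_trans nat (R (p1 y)) (p1 (p2 y)) (p2 (p2 y)) <->
      clos_refl_trans_1n nat (R (p1 y)) (p1 (p2 y)) (p2 (p2 y)).
    exact: clos_rt_rt1n_iff.
  split=> [[t [n [/eqP <- /eqP <-]]]|].
    elim: n t => [|n IH] t tP; first exact: rt1n_refl.
    apply: (Relation_Operators.rt1n_trans _ _ _ (e 1 t)); first exact: tP.
    by rewrite !eS; apply: IH => j jn; rewrite -!eS; apply: tP.
  rewrite /P; elim=> [x|x u v Rxu _ [t [n [/eqP ex /eqP en tP]]]].
    by exists (pairing x 0), 0; rewrite e0 pairingK1.
  exists (pairing x t), n.+1; split=> [||[|j] jn].
  - by rewrite e0 pairingK1.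
  - by rewrite eS pairingK2 -en.
  - by rewrite eS pairingK2 ex e0 pairingK1.
  - by rewrite (eS j) (eS j.+1) pairingK2; apply: tP.
apply: (semidecidable_ex (P := fun t y => exists n, P n t y)).
apply: (semidecidable_ex (P := fun n y => P n (p1 y) (p2 y))).
pose P' z := (e 0 (p1 (p2 z)) == p1 (p2 (p2 (p2 z)))) &&
  (e (p1 z) (p1 (p2 z)) == p2 (p2 (p2 (p2 z)))).
apply: (@eq_semidecidable (fun z => P' z /\ forall j, j < p1 z ->
   R (p1 (p2 (p2 z))) (e j (p1 (p2 z))) (e j.+1 (p1 (p2 z))))).
  by move=> z; rewrite /P /P'; split=> [[/andP[]]|[-> ->]].
apply: semidecidable_and.
  by apply: (semidecidable_decidable (b := P')); rewrite /P'; computability.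
apply: (semidecidable_forall_lt (P := fun j z =>
   R (p1 (p2 (p2 z))) (e j (p1 (p2 z))) (e j.+1 (p1 (p2 z))))) => //.
have gC : computable1 (fun y => pairing (p1 (p2 (p2 (p2 y))))
    (pairing (e (p1 y) (p1 (p2 (p2 y)))) (e (p1 y).+1 (p1 (p2 (p2 y)))))).
  by computability.
apply: eq_semidecidable (semidecidable_comp RC gC) => z.
by rewrite !(pairingK1, pairingK2).
Qed.

(** * Recursively enumerable sets and their indices *)

Section Enumeration.
Variable phi : nat -> nat -> option nat.
Hypothesis phiP : standard_enumeration phi.

Lemma semidecidable_W : semidecidable (fun y => W phi (p1 y) (p2 y)).
Proof.
have [[c cP] _] := phiP; have [st [stC _ stP]] := murec_stages c.
exists (fun y t => 0 < st t (pairing (p1 y) (pairing (p2 y) 0))) => [|y].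
  by apply/computable2P; computability.
have {}cP r : phi (p1 y) (p2 y) = Some r <->
    exists t, st t (pairing (p1 y) (pairing (p2 y) 0)) = r.+1.
  by rewrite -cP stP.
rewrite /W; split=> [|[t]].
  case E: (phi _ _) => [r|] // _; have /cP[t tr] := E.
  by exists t; rewrite tr.
case E: (st _ _) => [//|r] _.
by have /cP -> : exists t, st t (pairing (p1 y) (pairing (p2 y) 0)) = r.+1
  by exists t.
Qed.

(** The search for a stage is a partial computable function of [a] and [x], and the s-m-n property
    turns [a] into an index. *)
Lemma semidecidable_index P : semidecidable P ->
  exists2 s, computable1 s & forall a x, W phi (s a) x <-> P (pairing a x).
Proof.
move=> [Q QC QP].
(* [MMin] looks for a zero, hence the negation. *)
have nQC : computable2 (fun z t => ~~ Q z t).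
  by apply/computable2P; computability.
have [c cP] := tcomputable_app2 nQC (tcomputable_app2 pairingC
  (tcomputable_proj (inord 1 : 'I_3)) (tcomputable_proj (inord 2)))
  (tcomputable_proj ord0).
pose f a x := if pselect (exists t, Q (pairing a x) t) is left e
  then Some (ex_minn e) else None.
have fC : partial_computable2 f.
  exists (MMin c) => a x r.
  have -> : murec_eval (MMin c) [tuple a; x] r <-> Q (pairing a x) r /\
      forall m, m < r -> ~~ Q (pairing a x) m.
    have E m y : murec_eval c [tuple of m :: [tuple a; x]] y <->
        ~~ Q (pairing a x) m = y :> nat.
      by rewrite cP !(tnth_nth 0) !inordK.
    rewrite /= E; split=> -[Qr Qm].
      split=> [|m /Qm[y /E]]; last by case: (Q _ m).
      by move: Qr; case: (Q _ r).
    split=> [|m /Qm Q0]; first by rewrite Qr.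
    by exists 0; apply/E; rewrite Q0.
  rewrite /f; case: pselect => [e|ne]; last first.
    by split=> // -[Qr]; case: ne; exists r.
  case: ex_minnP => m Qm m_min; split=> [[Qr r_min]|[<-]].
    congr Some; apply/eqP; rewrite eqn_leq m_min // leqNgt.
    by apply/negP => /r_min; rewrite Qm.
  split=> // n nm; apply/negP => /m_min.
  by rewrite leqNgt nm.
have [s sC sP] := phiP.2 f fC; exists s => // a x.
rewrite QP /W sP /f; case: pselect => [e|ne]; first by split.
by split.
Qed.
End Enumeration.

(** * Word problems and names *)

Section Words.
Variables (theta : forall n, nat -> word n) (k : nat) (code : word k -> nat).
Hypothesis thetaP : computable_word_numbering theta.
Hypotheses (thetaK : cancel (theta k) code) (codeK : cancel code (theta k)).

Let sz x := size (theta k x).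
Let lc x j := nth 0 (map (@letter_code k) (theta k x)) j.

Lemma letter_code_inj : injective (@letter_code k).
Proof.
move=> [i b] [j c]; rewrite /letter_code /= => E; congr (_, _).
  apply/val_inj; move/(congr1 half): E => /=.
  by rewrite !(addnC _.*2) !half_bit_double.
move/(congr1 odd): E; rewrite !oddD !odd_double /=.
by case: b c => -[].
Qed.

Lemma size_computable : computable1 sz.
Proof.
case: thetaP => _ szC _; apply: (computable1_app2 szC (computable1_const k)).
exact: computable1_id.
Qed.

Lemma letter_computable : computable2 lc.
Proof.
case: thetaP => _ _ lcC; apply/computable2P.
by apply: (computable1_app3 lcC (computable1_const k)); computability.
Qed.

Lemma eq_word (u v : word k) : size u = size v ->
  (forall j, j < size v -> nth 0 (map (@letter_code k) u) j =
                           nth 0 (map (@letter_code k) v) j) -> u = v.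
Proof.
move=> szE uv; apply: (inj_map letter_code_inj).
by apply: (@eq_from_nth _ 0); rewrite ?size_map // szE.
Qed.

(** Only decoding is given as computable, so the code of a concatenation is found by search: the
    length and the letters of the candidate are compared with the expected ones. *)
Lemma cat_computable : computable2 (fun x y => code (theta k x ++ theta k y)).
Proof.
have [szC lcC] := (size_computable, letter_computable).
pose P z y := (sz z == sz (p1 y) + sz (p2 y)) &&
  all (fun j => lc z j == if j < sz (p1 y) then lc (p1 y) j
                          else lc (p2 y) (j - sz (p1 y))) (iota 0 (sz z)).
have PP z y : P z y <-> theta k z = theta k (p1 y) ++ theta k (p2 y).
  rewrite /P /sz /lc; split=> [/andP[/eqP szE /allP zE]|zE].
    apply: eq_word => [|j jlt]; first by rewrite size_cat.
    rewrite (eqP (zE j _)) ?mem_iota; last by rewrite szE -size_cat.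
    by rewrite map_cat nth_cat size_map.
  rewrite zE size_cat eqxx; apply/allP => j _.
  by rewrite map_cat nth_cat size_map.
have PC : computable1 (fun y => P (p1 y) (p2 y)).
  rewrite /P; computability; apply: (computable1_all (P := fun j y =>
    lc (p1 y) j == if j < sz (p1 (p2 y)) then lc (p1 (p2 y)) j
                   else lc (p2 (p2 y)) (j - sz (p1 (p2 y))))); computability.
have [f fC fP] := computable1_search PC (fun y =>
  ex_intro _ (code (theta k (p1 y) ++ theta k (p2 y)))
    (iffRL (PP _ _) (codeK _))).
apply/computable2P; congr computable1: fC; apply/funext => y.
by have /PP <- := fP y.
Qed.

Definition cancelling r :=
  exists a : letter k, theta k r = [:: a; letter_inv a].

(** Two letters cancel when their codes have the same half, that is the same generator, but
    differ. *)
Lemma semidecidable_cancelling : semidecidable cancelling.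
Proof.
have [szC lcC] := (size_computable, letter_computable).
apply: (@eq_semidecidable (fun r => [&& sz r == 2, (lc r 0)./2 == (lc r 1)./2
  & lc r 0 != lc r 1])); last first.
  by apply: (semidecidable_decidable (b := fun r => [&& sz r == 2,
    (lc r 0)./2 == (lc r 1)./2 & lc r 0 != lc r 1])); computability.
have halfE (a : letter k) : (letter_code a)./2 = a.1.
  by rewrite /letter_code addnC half_bit_double.
move=> r; rewrite /cancelling /sz /lc.
split=> [|[a ->] /=]; last first.
  rewrite !halfE eqxx /= (inj_eq letter_code_inj) /letter_inv.
  by case: a => i b; rewrite xpair_eqE eqxx; case: b.
case: (theta k r) => [|a [|b [|]]] //= /andP[].
rewrite !halfE (inj_eq letter_code_inj) => /eqP ab a_b.
exists a; congr [:: _; _]; case: a b ab a_b => i b [j c] /= /val_inj <-.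
by rewrite xpair_eqE eqxx /= /letter_inv; case: b c => -[].
Qed.

(** Rewriting steps are transported to codes of words, where reachability is semidecidable,
    uniformly in the index of the relator set. *)
Lemma semidecidable_pres_eq (A : nat -> nat -> Prop) :
    semidecidable (fun y => A (p1 y) (p2 y)) ->
  semidecidable (fun y => pres_eq (fun w => exists2 x, A (p1 y) x & theta k x = w)
                            (theta k (p2 y)) [::]).
Proof.
move=> AC; have catC := cat_computable.
set cat := fun x y => _ in catC.
pose R i u v := exists p q r, (A i r \/ cancelling r) /\
  ((u == cat p q) && (v == cat p (cat r q)) ||
   (v == cat p q) && (u == cat p (cat r q))).
have catE u p q : (u == cat p q) = (theta k u == theta k p ++ theta k q).
  by rewrite -(can_eq codeK) thetaK.
have RE i u v : R i u v <-> relator_step (fun w => exists2 x, A i x & theta k x = w)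
    (theta k u) (theta k v).
  split=> [[p [q [r [Ar uv]]]]|[p q r Ar uv]].
    exists (theta k p) (theta k q) (theta k r).
      by case: Ar; [left; exists r|right].
    by move: uv; rewrite !catE codeK => /orP[]/andP[/eqP-> /eqP->]; [left|right].
  exists (code p), (code q), (code r); rewrite !catE !codeK; split.
    by case: Ar => [[x Ax <-]|]; rewrite ?thetaK ?/cancelling ?codeK; [left|right].
  by case: uv => -[-> ->]; rewrite !eqxx ?orbT.
have RC : semidecidable (fun y => R (p1 y) (p1 (p2 y)) (p2 (p2 y))).
  pose B p q r y := (A (p1 y) r \/ cancelling r) /\
    ((p1 (p2 y) == cat p q) && (p2 (p2 y) == cat p (cat r q)) ||
     (p2 (p2 y) == cat p q) && (p1 (p2 y) == cat p (cat r q))).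
  apply: (semidecidable_ex (P := fun p y => exists q r, B p q r y)).
  apply: (semidecidable_ex (P := fun q z => exists r, B (p1 z) q r (p2 z))).
  apply: (semidecidable_ex
    (P := fun r z => B (p1 (p2 z)) (p1 z) r (p2 (p2 z)))).
  apply: semidecidable_and; last first.
    by apply: (@semidecidable_decidable (fun _ => _ || _)); computability.
  apply: semidecidable_or.
    have gC : computable1 (fun z => pairing (p1 (p2 (p2 (p2 z)))) (p1 z)).
      by computability.
    apply: eq_semidecidable (semidecidable_comp AC gC) => z.
    by rewrite pairingK1 pairingK2.
  by apply: (semidecidable_comp semidecidable_cancelling); computability.
have gC : computable1 (fun y => pairing (p1 y) (pairing (p2 y) (code [::]))).
  by computability.
apply: eq_semidecidable (semidecidable_comp (semidecidable_connect RC) gC) => y.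
rewrite !(pairingK1, pairingK2) pres_eq_steps.
rewrite -[X in _ <-> clos_refl_trans _ _ _ X]codeK.
split; first elim=> [u v /RE|u|u v w _ IH _ IH'].
- exact: rt_step.
- exact: rt_refl.
- exact: rt_trans IH IH'.
rewrite -[X in _ -> clos_refl_trans _ _ _ X]thetaK.
rewrite -[X in _ -> clos_refl_trans _ _ X _]thetaK.
elim=> [u v uv|u|u v w _ IH _ IH'].
- by apply/rt_step/RE; rewrite !codeK.
- exact: rt_refl.
- exact: rt_trans IH IH'.
Qed.

Lemma computable2_total h :
  computable2 h -> partial_computable2 (fun x y => Some (h x y)).
Proof.
by case=> c cP; exists c => x y r; rewrite cP; split=> [->|[->]].
Qed.

(** All names of [k]-marked groups share the first component [k], so an operation only has to
    transform the second ones. *)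
Lemma computable_op_index (nu : numbering)
    (op : marked_group k -> marked_group k -> marked_group k) s :
    (forall a G, nu k a G -> exists i, a = pairing k i) -> computable1 s ->
    (forall i j G H, nu k (pairing k i) G -> nu k (pairing k j) H ->
      nu k (pairing k (s (pairing i j))) (op G H)) ->
  computable_op nu op.
Proof.
move=> nu_pair sC sP; exists
    (fun a b => Some (pairing k (s (pairing (p2 a) (p2 b))))) => [|a b G H].
  by apply/computable2_total/computable2P; computability.
move=> aG bH; have [i ai] := nu_pair _ _ aG; have [j bj] := nu_pair _ _ bH.
rewrite ai in aG; rewrite bj in bH; rewrite ai bj !pairingK2.
by exists (pairing k (s (pairing i j))) => //; apply: sP.
Qed.

Lemma pairing_inj i j : pairing k i = pairing k j -> i = j.
Proof. by move/(congr1 p2); rewrite !pairingK2. Qed.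

(** * Canonical indices of finite sets, and the meet of finitely presented groups *)

Lemma divn_exp2 m x : m %/ 2 ^ x = iter x half m.
Proof.
elim: x => [|x IH]; first by rewrite divn1.
by rewrite expnSr divnMA IH divn2.
Qed.

Lemma Delta_computable : computable2 (fun m x => Delta m x).
Proof.
apply/computable2P/computable1_odd.
have -> : (fun z => p1 z %/ 2 ^ p2 z) =
    fun z => iteri (p2 z) (fun _ a => a./2) (p1 z).
  by apply/funext => z; rewrite divn_exp2; elim: (p2 z) => //= n ->.
by apply: (computable1_iteri (s := fun _ a _ => a./2)); computability.
Qed.

Lemma Delta_lt m x : Delta m x -> x < m.
Proof.
rewrite /Delta; case: (leqP m x) => // mx.
by rewrite divn_small // (leq_ltn_trans mx) // ltn_expl.
Qed.

Lemma Delta_surj n (A : pred nat) :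
  exists m, forall x, Delta m x = (x < n) && A x.
Proof.
suff [m mn mP] : exists2 m, m < 2 ^ n & forall x, Delta m x = (x < n) && A x.
  by exists m.
elim: n => [|n [m mn mP]].
  by exists 0 => // x; rewrite /Delta div0n.
exists (m + A n * 2 ^ n) => [|x].
  rewrite expnS mul2n -addnn -addSn leq_add //.
  by case: (A n); rewrite ?mul0n ?mul1n.
have [xn|nx|->] := ltngtP x n.
- rewrite ltnS ltnW //= -[A x]/(true && A x) -xn -mP /Delta.
  (* For [x < n] the added term is an even multiple of [2 ^ x], so bit [x] is unchanged. *)
  have -> : A n * 2 ^ n = (A n * 2 ^ (n - x.+1)).*2 * 2 ^ x.
    by rewrite -muln2 -!mulnA -expnS -expnD subnK.
  by rewrite divnDMl ?expn_gt0 // oddD odd_double addbF.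
- rewrite ltnS leqNgt nx /= /Delta divn_small // (@leq_trans (2 ^ n.+1)) //.
    rewrite expnS mul2n -addnn -addSn leq_add //.
    by case: (A n); rewrite ?mul0n ?mul1n.
  by rewrite leq_exp2l.
by rewrite ltnSn /Delta divnDMl ?expn_gt0 // divn_small //= oddb.
Qed.

(** The index is found by search. Equality of the sets is decidable because the elements of
    [Delta m] are smaller than [m]. *)
Lemma Delta_union : exists2 u, computable1 u &
  forall i j x, Delta (u (pairing i j)) x = Delta i x || Delta j x.
Proof.
pose P m y := all (fun x => nat_of_bool (Delta m x) ==
  nat_of_bool (Delta (p1 y) x || Delta (p2 y) x)) (iota 0 (m + (p1 y + p2 y))).
have PP m y :
    P m y <-> forall x, Delta m x = Delta (p1 y) x || Delta (p2 y) x.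
  split=> [/allP PE x|DE]; last by apply/allP => x _; rewrite DE.
  have [xlt|xge] := ltnP x (m + (p1 y + p2 y)).
    have := PE x; rewrite mem_iota => /(_ xlt)/eqP.
    by case: (Delta m x); case: (Delta (p1 y) x || Delta (p2 y) x).
  have DF a : a <= m + (p1 y + p2 y) -> Delta a x = false.
    move=> alt; apply/negbTE/negP => /Delta_lt.
    by rewrite ltnNge (leq_trans alt).
  by rewrite !DF ?leq_addr // addnCA ?leq_addr // addnA leq_addl.
have PC : computable1 (fun y => P (p1 y) (p2 y)).
  have DC := Delta_computable.
  apply: (computable1_all (P := fun x y => nat_of_bool (Delta (p1 y) x) ==
    nat_of_bool (Delta (p1 (p2 y)) x || Delta (p2 (p2 y)) x)));
  by computability.
have [|f fC fP] := computable1_search PC.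
  move=> y; have [m mP] := Delta_surj (p1 y + p2 y)
    (fun x => Delta (p1 y) x || Delta (p2 y) x).
  exists m; apply/PP => x; rewrite mP andb_idl // => /orP[] /Delta_lt xlt.
    exact: ltn_addr.
  exact: ltn_addl.
exists f => // i j x; have /PP -> := fP (pairing i j).
by rewrite pairingK1 pairingK2.
Qed.

Lemma computable_op_FP_meet : computable_op (nu_FP pairing theta) (@mg_meet k).
Proof.
have [u uC uP] := Delta_union; apply: computable_op_index uC _ => [a G [m ->]|].
  by exists m.
move=> i j G H [m /pairing_inj <- iG] [m' /pairing_inj <- jH].
exists (u (pairing i j)) => //; apply: pres_meet_iso iG jH _ => w.
rewrite /theta_image; split=> [[x]|].
  by rewrite uP => /orP[]; [left|right]; exists x.
by case=> -[x xA]; exists x; rewrite // uP xA ?orbT.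
Qed.

(** * Operations on recursively and co-recursively presented groups *)

Variable phi : nat -> nat -> option nat.
Hypothesis phiP : standard_enumeration phi.

Lemma W_index_comp f : computable1 f ->
  semidecidable (fun y => W phi (f y) (p2 y)).
Proof.
move=> fC; have gC : computable1 (fun y => pairing (f y) (p2 y)).
  by computability.
apply: eq_semidecidable (semidecidable_comp (semidecidable_W phiP) gC) => y.
by rewrite pairingK1 pairingK2.
Qed.

Lemma W_union : exists2 u, computable1 u &
  forall i j x, W phi (u (pairing i j)) x <-> W phi i x \/ W phi j x.
Proof.
have [|u uC uP] := semidecidable_index phiP
  (P := fun y => W phi (p1 (p1 y)) (p2 y) \/ W phi (p2 (p1 y)) (p2 y)).
  by apply: semidecidable_or; apply: W_index_comp; computability.
by exists u => // i j x; rewrite uP !(pairingK1, pairingK2).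
Qed.

Lemma theta_image_W_union u i j :
    (forall x, W phi (u (pairing i j)) x <-> W phi i x \/ W phi j x) ->
  forall w : word k, theta_image theta (W phi (u (pairing i j))) w <->
    theta_image theta (W phi i) w \/ theta_image theta (W phi j) w.
Proof.
move=> uP w; rewrite /theta_image; split=> [[x /uP[]]|].
- by left; exists x.
- by right; exists x.
by case=> -[x xA]; exists x; rewrite // uP; [left|right].
Qed.

Lemma computable_op_RP_meet :
  computable_op (nu_RP pairing theta phi) (@mg_meet k).
Proof.
have [u uC uP] := W_union; apply: computable_op_index uC _ => [a G [m ->]|].
  by exists m.
move=> i j G H [m /pairing_inj <- iG] [m' /pairing_inj <- jH].
exists (u (pairing i j)) => //.
exact: pres_meet_iso iG jH (theta_image_W_union _).
Qed.

(** The join is presented by the intersection of the two word problems, not of the given relator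
    sets; so the consequences are enumerated first. *)
Lemma computable_op_RP_join :
  computable_op (nu_RP pairing theta phi) (@mg_join k).
Proof.
have WC : semidecidable (fun y => pres_eq (theta_image theta (W phi (p1 y)))
    (theta k (p2 y)) [::]).
  exact: (semidecidable_pres_eq (A := fun i x => W phi i x) (semidecidable_W phiP)).
have EC f : computable1 f ->
    semidecidable (fun y => pres_eq (theta_image theta (W phi (f y)))
      (theta k (p2 y)) [::]).
  move=> fC; have gC : computable1 (fun y => pairing (f y) (p2 y)).
    by computability.
  apply: eq_semidecidable (semidecidable_comp WC gC) => y.
  by rewrite pairingK1 pairingK2.
have p11C : computable1 (fun y => p1 (p1 y)) by computability.
have p21C : computable1 (fun y => p2 (p1 y)) by computability.
have [s sC sP] :=
  semidecidable_index phiP (semidecidable_and (EC _ p11C) (EC _ p21C)).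
apply: computable_op_index sC _ => [a G [m ->]|]; first by exists m.
move=> i j G H [m /pairing_inj <- iG] [m' /pairing_inj <- jH].
exists (s (pairing i j)) => //.
have -> : theta_image theta (W phi (s (pairing i j))) =
    fun w : word k => mg_eval (mg_join G H) w = 1%g.
  apply/funext => w; apply/propext; rewrite join_eval.
  move/mg_iso_wordP: iG => <-; move/mg_iso_wordP: jH => <-.
  rewrite !presented_eval -[w]codeK; split=> [[x /sP + <-]|].
    by rewrite !(pairingK1, pairingK2).
  by move=> ij; exists (code w) => //; apply/sP; rewrite !(pairingK1, pairingK2).
exact: presented_wordsK.
Qed.

Lemma theta_image_code (A : pred nat) w : theta_image theta A w <-> A (code w).
Proof.
split=> [[x Ax <-]|Aw]; first by rewrite thetaK.
by exists (code w); rewrite ?codeK.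
Qed.

(** The complement of the co-word problem of [H] is the set of all relations of [H], so the group it
    presents is [H] itself. *)
Lemma nu_coRP_wordP i (G : marked_group k) :
  nu_coRP pairing theta phi (pairing k i) G <->
  forall w, W phi i (code w) <-> mg_eval G w <> 1%g.
Proof.
split=> [[j [/pairing_inj <- [H HP]]]|GP].
  have -> : (fun w : word k => ~ theta_image theta (W phi i) w) =
      fun w => mg_eval H w = 1%g.
    by apply/funext => w; apply/propext; rewrite HP; split=> [/contrapT|Gw /(_ Gw)].
  move=> /mg_iso_wordP HG w; rewrite -theta_image_code HP -HG.
  by have /mg_iso_wordP -> := presented_wordsK H.
have GE (w : word k) : theta_image theta (W phi i) w <-> mg_eval G w <> 1%g.
  by rewrite theta_image_code.
exists i; split=> //; first by exists G.
have -> : (fun w : word k => ~ theta_image theta (W phi i) w) =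
    fun w => mg_eval G w = 1%g.
  by apply/funext => w; apply/propext; rewrite GE; split=> [/contrapT|Gw /(_ Gw)].
exact: presented_wordsK.
Qed.

(** A word is nontrivial in the join when it is so in one of the groups, so co-word problems are
    united. *)
Lemma computable_op_coRP_join :
  computable_op (nu_coRP pairing theta phi) (@mg_join k).
Proof.
have [u uC uP] := W_union; apply: computable_op_index uC _ => [a G [m [-> _ _]]|].
  by exists m.
move=> i j G H /nu_coRP_wordP GP /nu_coRP_wordP HP; apply/nu_coRP_wordP => w.
rewrite uP GP HP join_eval; split=> [[Gw|Hw] []//|GHw].
by case: (pselect (mg_eval G w = 1%g)) => [Gw|]; [right=> Hw; apply: GHw|left].
Qed.
End Words.

(** Brings the action of a word into the form that [computable1_iteri] accepts. *)
Lemma foldl_iteri (A B : Type) (f : A -> B -> A) x0 (s : seq B) a :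
  foldl f a s = iteri (size s) (fun j a => f a (nth x0 s j)) a.
Proof.
have eq_lt n (g h : nat -> A -> A) : (forall j, j < n -> g j =1 h j) ->
    iteri n g a = iteri n h a.
  elim: n => //= n IH gh; rewrite IH ?gh // => j jn.
  exact/gh/ltnW.
elim/last_ind: s => // s x IH; rewrite foldl_rcons size_rcons /=.
rewrite nth_rcons ltnn eqxx IH; congr f; apply: eq_lt => j js b.
by rewrite nth_rcons js.
Qed.

(** * A meet that is not co-recursively presented *)

Section MeetNotCoRP.
Variables (theta : forall n, nat -> word n) (code : word 4 -> nat).
Hypothesis thetaP : computable_word_numbering theta.
Hypotheses (thetaK : cancel (theta 4) code) (codeK : cancel code (theta 4)).
Variable phi : nat -> nat -> option nat.
Hypothesis phiP : standard_enumeration phi.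

Let enc (x : nat * (nat * nat)) := pairing x.1 (pairing x.2.1 x.2.2).
Let dec q := (p1 q, (p1 (p2 q), p2 (p2 q))).

Lemma encK : cancel enc dec.
Proof. by case=> m [n r]; rewrite /enc /dec !(pairingK1, pairingK2). Qed.

Lemma walk_computable e f :
  computable1 f -> computable1 (fun z => walk e (f z)).
Proof.
rewrite /walk; move=> fC.
have -> : (fun z => if odd (f z) (+) e then (f z).-1 else (f z).+1) =
    fun z => if odd (f z) == e :> nat then (f z).+1 else (f z).-1.
  by apply/funext => z; case: e; case: odd.
by computability.
Qed.

Lemma transp_computable i f :
  computable1 f -> computable1 (fun z => transp i (f z)).
Proof. by rewrite /transp => fC; computability. Qed.

(** A word is nontrivial when it moves some point, and the search for such a point is effective
    because the generators are computable. *)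
Lemma coRP_family_act (c : nat -> pred nat) :
    computable2 (fun m n => c m n) ->
  presentable (nu_coRP pairing theta phi) (act_group (family_act c)).
Proof.
move=> cC.
pose F l q := let: (m, (n, r)) := dec q in pairing m (
  if l./2 == 0 then pairing (walk false n) r
  else if l./2 == 1 then pairing (walk true n) r
  else if l./2 == 2 then pairing n (if c m n then transp 0 r else r)
  else pairing n (if n == 0 then transp 1 r else r)).
have FE l x : F (letter_code l) (enc x) = enc (family_act c l x).
  rewrite /F encK; case: x => m [n r]; congr pairing.
  rewrite /letter_code addnC half_bit_double /family_act /fibre_act /=.
  by case: l => -[[|[|[|[|//]]]] i4] b.
have FC : computable2 F.
  apply/computable2P; rewrite /F /dec.
  by computability; do ?[apply: walk_computable|apply: transp_computable];
     computability.
have szC := size_computable 4 thetaP.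
have lcC := letter_computable 4 thetaP.
set lc := fun x j => _ in lcC; set sz := fun x => _ in szC.
pose A x q := iteri (sz x) (fun j a => F (lc x j) a) q.
have AE x y : A x (enc y) = enc (acts (family_act c) (theta 4 x) y).
  have -> : A x (enc y) =
      foldl (fun a l => F l a) (enc y) (map (@letter_code 4) (theta 4 x)).
    by rewrite (foldl_iteri _ 0) size_map.
  by elim: (theta 4 x) y => //= l w IH y; rewrite FE IH.
have AC : computable2 A.
  apply/computable2P; apply: (computable1_iteri
    (s := fun j a y => F (lc (p1 y) j) a)); by computability.
(* The search runs over all integers; [enc (dec q)] is always the code of a point. *)
pose moved x q := A x (enc (dec q)) != enc (dec q).
have movedC : semidecidable (fun x => exists q, moved (p2 x) q).
  apply: (semidecidable_ex (P := fun q x => moved (p2 x) q)).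
  apply: (semidecidable_decidable (b := fun z => moved (p2 (p2 z)) (p1 z))).
  by rewrite /moved /enc /dec /=; computability.
have [s sC sP] := semidecidable_index phiP movedC.
(* The set tested by [movedC] does not depend on the parameter, for which 0 is an arbitrary
   choice. *)
exists (pairing 4 (s 0)); apply/(nu_coRP_wordP thetaK codeK) => w.
rewrite sP pairingK2 act_group_eq1; last exact: family_actK.
have mE q : moved (code w) q <-> acts (family_act c) w (dec q) <> dec q.
  rewrite /moved AE codeK; split=> [/eqP aq e|aq]; first by rewrite e in aq.
  by apply/eqP => /(can_inj encK).
split=> [[q /mE aq] /(_ (dec q))|wid] //.
apply: contrapT => nex; apply: wid => y; apply: contrapT => wy.
by apply: nex; exists (enc y); apply/mE; rewrite encK.
Qed.

Lemma comm_word_computable : computable1 (fun n => code (comm_word n)).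
Proof.
have catC := cat_computable thetaP thetaK codeK.
set cat := fun x y => _ in catC.
have catE u v : code (u ++ v) = cat (code u) (code v) by rewrite /cat !codeK.
pose st m := if odd m then code [:: stepl true] else code [:: stepl false].
have stE m : code [:: stepl (odd m)] = st m by rewrite /st; case: odd.
have stC : computable1 st by rewrite /st; computability.
have pathC : computable1 (fun n => code (path_word n)).
  have -> : (fun n => code (path_word n)) =
      fun n => iteri n (fun m a => cat a (st m)) (code [::]).
    by apply/funext; elim=> //= n <-; rewrite catE stE.
  by apply: (computable1_iteri (s := fun m a _ => cat a (st m))); computability.
have backC : computable1 (fun n => code (back_word n)).
  have -> : (fun n => code (back_word n)) =
      fun n => iteri n (fun m a => cat (st m) a) (code [::]).
    by apply/funext; elim=> // n /= <-; rewrite -cat1s catE stE.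
  by apply: (computable1_iteri (s := fun m a _ => cat (st m) a)); computability.
have probeC : computable1 (fun n => code (probe n)).
  have -> : (fun n => code (probe n)) = fun n => cat (code (path_word n))
      (cat (code [:: mark]) (cat (code (back_word n)) (code [:: base]))).
    by apply/funext => n; rewrite /probe !catE.
  by computability.
have -> : (fun n => code (comm_word n)) =
    fun n => cat (code (probe n)) (code (probe n)).
  by apply/funext => n; rewrite /comm_word catE.
by computability.
Qed.

Lemma coRP_meet_witness : exists G H : marked_group 4,
  [/\ presentable (nu_coRP pairing theta phi) G,
      presentable (nu_coRP pairing theta phi) H
    & ~ presentable (nu_coRP pairing theta phi) (mg_meet G H)].
Proof.
have diagC : computable1 (fun m => pairing m m) by computability.
have [Q QC QP] := semidecidable_comp (semidecidable_W phiP) diagC.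
have {}QP m : W phi m m <-> exists t, Q m t.
  by rewrite -QP pairingK1 pairingK2.
(* Each position is marked in at most one fibre, the one given by [n./2] or [p1 n./2], so
   [comm_word n] moves points in that fibre only. *)
pose c1 m : pred nat := fun n =>
  if odd n then (p1 n./2 == m) && Q m (p2 n./2) else n./2 == m.
pose c2 m : pred nat := fun n => if odd n then false else n./2 == m.
have c1C : computable2 (fun m n => c1 m n).
  apply/computable2P; rewrite /c1.
  have -> : (fun z => nat_of_bool (if odd (p2 z)
      then (p1 (p2 z)./2 == p1 z) && Q (p1 z) (p2 (p2 z)./2)
      else (p2 z)./2 == p1 z)) =
    fun z => if odd (p2 z)
      then nat_of_bool ((p1 (p2 z)./2 == p1 z) && Q (p1 z) (p2 (p2 z)./2))
      else nat_of_bool ((p2 z)./2 == p1 z).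
    by apply/funext => z; case: ifP.
  by computability.
have c2C : computable2 (fun m n => c2 m n).
  apply/computable2P; rewrite /c2.
  have -> : (fun z => nat_of_bool (if odd (p2 z)
      then false else (p2 z)./2 == p1 z)) =
    fun z => if odd (p2 z) then 0 else nat_of_bool ((p2 z)./2 == p1 z).
    by apply/funext => z; case: ifP.
  by computability.
pose G := act_group (family_act c1); pose H := act_group (family_act c2).
exists G, H; split; [exact: coRP_family_act|exact: coRP_family_act|].
have fact_eq c := act_group_eq (family_actK c).
have actE c n1 n2 : (forall m, c m n1 = c m n2) ->
    acts (family_act c) (comm_word n1) =1 acts (family_act c) (comm_word n2).
  by move=> cE [m [y r]]; rewrite !acts_family !ev_comm_word cE.
have GM w : mg_eval G w = 1%g -> mg_eval (mg_meet G H) w = 1%g.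
  by move=> Gw; apply/presented_eval/PresRel; left.
have HM w : mg_eval H w = 1%g -> mg_eval (mg_meet G H) w = 1%g.
  by move=> Hw; apply/presented_eval/PresRel; right.
have meetP m : mg_eval (mg_meet G H) (comm_word m.*2) = 1%g <-> W phi m m.
  split=> [|/QP[t Qt]].
    apply: contraPP => /(contra_not (iffRL (QP m))) nQ.
    have cE : c1 m = c2 m.
      apply/funext => n; rewrite /c1 /c2; case: odd => //.
      apply/negbTE/negP => /andP[_ Qt]; apply: nQ.
      by exists (p2 n./2).
    (* Since [c1 m] and [c2 m] agree, this fibre is a common quotient of [G] and [H], hence of the
       meet; there the point (0, 0) is moved. *)
    pose K := act_group (fibre_act (c1 m)).
    have GK : mg_above (mg_meet G H) K.
      apply/mg_meetP; split; apply/presented_above => w wid;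
        apply/(act_group_eq1 (@fibre_actK _)) => x.
        by have := wid (m, x); rewrite acts_family => -[].
      by have := wid (m, x); rewrite acts_family -cE => -[].
    move/(iffLR (mg_aboveP _ _) GK)/(act_group_eq1 (@fibre_actK _))/(_ (0, 0)).
    by rewrite ev_comm_word /c1 odd_double doubleK !eqxx.
  (* In [G] the positions [m.*2] and [n] are marked in the same fibres; in [H] the odd position [n]
     is never marked. *)
  pose n := (pairing m t).*2.+1.
  have Gn : mg_eval G (comm_word m.*2) = mg_eval G (comm_word n).
    apply/fact_eq/actE => m'; rewrite /c1 /n /= !odd_double /= doubleK.
    rewrite uphalf_double pairingK1 pairingK2.
    by case: eqP => // <-; rewrite Qt.
  have Hn : mg_eval H (comm_word n) = 1%g.
    rewrite -(mg_eval_nil H); apply/fact_eq => -[m' [y r]].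
    by rewrite !acts_family ev_comm_word /c2 /n /= odd_double andbF.
  have /GM : mg_eval G (comm_word m.*2 ++ word_inv (comm_word n)) = 1%g.
    by rewrite mg_eval_cat mg_eval_inv Gn mulgV.
  by rewrite mg_eval_cat mg_eval_inv (HM _ Hn) invg1 mulg1.
case=> p pP; have [i [pi _ _]] := pP; rewrite pi in pP.
move/(nu_coRP_wordP thetaK codeK): pP => iP.
have gC := comm_word_computable.
have hC : computable1 (fun y => pairing i (code (comm_word (p2 y).*2))).
  have dC : computable1 (fun y => (p2 y).*2).
    have -> : (fun y => (p2 y).*2) = fun y => p2 y + p2 y.
      by apply/funext => y; rewrite addnn.
    by computability.
  by computability; apply: (computable1_comp gC).
(* A name of the meet would make the complement of the diagonal halting set equal to [W phi (s 0)];
   testing its own index [s 0] gives a contradiction. *)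
have [s _ sP] := semidecidable_index phiP
  (semidecidable_comp (semidecidable_W phiP) hC).
have := sP 0 (s 0); rewrite !(pairingK1, pairingK2) iP meetP.
by case: (pselect (W phi (s 0) (s 0))) => Ws E; have := Ws; [rewrite E|case/E].
Qed.
End MeetNotCoRP.
End Computable.

(** * Finite presentations of the witnesses, and assembly of the three statements *)

Lemma size_theta_image_Delta (theta : forall n, nat -> word n) k m (w : word k) :
  theta_image theta (Delta m) w -> size w <= \max_(x < m) size (theta k x).
Proof.
by case=> x /Delta_lt xm <-; apply: (bigmax_sup (Ordinal xm)).
Qed.

Lemma presentable_FP_kill pairing (theta : forall n, nat -> word n) (i : 'I_3) :
  bijective (theta 3) -> presentable (nu_FP pairing theta) (kill i).
Proof.
case=> code thetaK codeK; pose x := code [:: (i, false)].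
have [m mP] := Delta_surj x.+1 (pred1 x).
exists (pairing 3 m), m => //.
have -> : theta_image theta (Delta m) = fun w => w = [:: (i, false)].
  apply/funext => w; apply/propext; split=> [[y]|->].
    by rewrite mP => /andP[_ /eqP ->] <-; apply: codeK.
  by exists x; [rewrite mP ltnSn /= eqxx | apply: codeK].
exact/mg_iso_wordP.
Qed.

Theorem proposition35 (pairing : nat -> nat -> nat)
    (theta : forall n : nat, nat -> word n) (phi : nat -> nat -> option nat)
    (Hpair : computable_pairing pairing)
    (Htheta : computable_word_numbering theta)
    (Hphi : standard_enumeration phi) :
  [/\ forall k : nat, 0 < k ->
        computable_op (nu_RP pairing theta phi) (@mg_meet k) /\
        computable_op (nu_RP pairing theta phi) (@mg_join k),
      [/\ forall k : nat, 0 < k ->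
            computable_op (nu_FP pairing theta) (@mg_meet k),
          exists2 k : nat, 0 < k &
            ~ computable_op (nu_FP pairing theta) (@mg_join k),
          exists2 k : nat, 0 < k &
            exists G H : marked_group k,
              [/\ presentable (nu_FP pairing theta) G,
                  presentable (nu_FP pairing theta) H
                & ~ presentable (nu_FP pairing theta) (mg_join G H)]
        & exists2 k : nat, 0 < k &
            exists G H : marked_group k,
              [/\ free_group G, free_group H
                & ~ presentable (nu_FP pairing theta) (mg_join G H)]]
    & [/\ forall k : nat, 0 < k ->
            computable_op (nu_coRP pairing theta phi) (@mg_join k),
          exists2 k : nat, 0 < k &
            ~ computable_op (nu_coRP pairing theta phi) (@mg_meet k)
        & exists2 k : nat, 0 < k &
            exists G H : marked_group k,
              [/\ presentable (nu_coRP pairing theta phi) G,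
                  presentable (nu_coRP pairing theta phi) H
                & ~ presentable (nu_coRP pairing theta phi) (mg_meet G H)]]].
Proof.
have [pairingC [p1 [p2 [p1C p2C pairingK _]]]] := Hpair.
have pairingK1 n m : p1 (pairing n m) = n := (pairingK n m).1.
have pairingK2 n m : p2 (pairing n m) = m := (pairingK n m).2.
have [theta_bij _ _] := Htheta.
(* A computable operation yields a name of its result, so one pair whose result has no name refutes
   computability. *)
have not_computable (nu : numbering) k op (G H : marked_group k) :
    presentable nu G -> presentable nu H -> ~ presentable nu (op G H) ->
    ~ computable_op nu op.
  move=> [a aG] [b bH] nop [F _ FP]; apply: nop.
  by have [c _ cGH] := FP a b G H aG bH; exists c.
have join_not_FP : ~ presentable (nu_FP pairing theta)
    (mg_join (kill (inord 2)) (kill (inord 1))).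
  move=> [p [m _]]; apply: join_kill_not_fp => w.
  exact: size_theta_image_Delta.
have kill_FP i := presentable_FP_kill pairing i (theta_bij 3 isT).
have [code4 theta4K code4K] := theta_bij 4 isT.
have [G [H [GP HP GHP]]] := coRP_meet_witness pairingC p1C p2C pairingK1 pairingK2
  Htheta theta4K code4K Hphi.
split=> [k k_gt0||].
- have [code thetaK codeK] := theta_bij k k_gt0.
  split; first exact: (computable_op_RP_meet pairingC p1C p2C pairingK1 pairingK2).
  exact: (computable_op_RP_join pairingC p1C p2C pairingK1 pairingK2 Htheta
    thetaK codeK).
- split=> [k k_gt0|||].
  + exact: (computable_op_FP_meet pairingC p1C p2C pairingK1 pairingK2).
  + by exists 3 => //; apply: not_computable join_not_FP.
  + by exists 3 => //; exists (kill (inord 2)), (kill (inord 1)).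
  + exists 3 => //; exists (kill (inord 2)), (kill (inord 1)).
    by split=> //; apply: free_kill_generator.
- split=> [k k_gt0||].
  + have [code thetaK codeK] := theta_bij k k_gt0.
    exact: (computable_op_coRP_join pairingC p1C p2C pairingK1 pairingK2
      thetaK codeK).
  + by exists 4 => //; apply: not_computable GHP.
  + by exists 4 => //; exists G, H.
Qed.
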